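(* Consider the source-coding scheme inside a feedback loop described in the context, i.e. for every $k\in\mathbb{N}_0=\{0,1,2,\dots\}$, $$y(k)=\mathscr{F}_k(u^{k-1},d^k,x_o),\quad s(k)=\mathcal{E}_k(y^k,S_{\mathcal{E}}^k),\quad s_c(k)=\mathcal{H}_k(s^k,S_{\mathrm{EC}}^k),\quad s(k)=\mathcal{H}_k^{-1}(s_c^k,S_{\mathrm{EC}}^k),\quad u(k)=\mathcal{D}_k(s^k,S_{\mathcal{D}}^k),$$ and let $R(i)$ be the expected length (in bits) of the binary word $s_c(i)$. Let $\mathcal{S}_{\mathcal{E}}(i)=(S_{\mathcal{E}}(i),S_{\mathrm{EC}}(i))$ and $\mathcal{S}_{\mathcal{D}}(i)=(S_{\mathcal{D}}(i),S_{\mathrm{EC}}(i))$ denote the total side information at the encoder side and at the decoder side at time $i$. Suppose that, for every $k\in\mathbb{N}_0$, (i) $(\mathcal{S}_{\mathcal{E}}^{k},\mathcal{S}_{\mathcal{D}}^{k})$ is independent of $(x_o,d^k)$; and (ii) for every $i=0,1,\dots,k-1$, the Markov chain $$(\mathcal{S}_{\mathcal{D}}(i+1),\mathcal{S}_{\mathcal{D}}(i+2),\dots,\mathcal{S}_{\mathcal{D}}(k))\leftrightarrow \mathcal{S}_{\mathcal{D}}^{i}\leftrightarrow \mathcal{S}_{\mathcal{E}}^{i}$$ holds. Then, for all $k\in\mathbb{N}_0$, $$\sum_{i=0}^{k}R(i)\;\geq\; I(y^k\to u^k).$$ Thus, $$\limsup_{k\to\infty}\frac{1}{k+1}\sum_{i=0}^{k}R(i)\geq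 \limsup_{k\to\infty}\frac{1}{k+1}I(y^k\to u^k),$$ $$\liminf_{k\to\infty}\frac{1}{k+1}\sum_{i=0}^{k}R(i)\geq \liminf_{k\to\infty}\frac{1}{k+1}I(y^k\to u^k).$$
   Context: Notation. For a random sequence $x=x(0),x(1),\dots$, write $x^k=(x(0),x(1),\dots,x(k))$; $x^{-1}$ is empty. All random variables live on a common probability space. The Markov chain notation $a\leftrightarrow b\leftrightarrow c$ means that $a$ and $c$ are conditionally independent given $b$. Information measures (in bits, logarithms to base 2). For random variables $x,y$ with joint distribution $m$ and product of marginals $\pi$, $I(x;y)=\int\log\frac{dm}{d\pi}\,dm$ (equal to $+\infty$ if $m$ is not absolutely continuous with respect to $\pi$). Conditional mutual information $I(x;y\mid z)$ is the usual one, satisfying the chain rule $I(x;y\mid z)=I(x;y,z)-I(x;z)=I(x,z;y)-I(z;y)$. The directed information from $y^k$ to $u^k$ (for a zero-delay forward channel, as is the case here since all encoders and decoders operate without delay) is $$I(y^k\to u^k)=\sum_{i=0}^{k}I(u(i);y^i\mid u^{i-1}).$$ Feedback source-coding scheme. - Plant: $y(k)=\mathscr{F}_k(u^{k-1},d^k,x_o)$, where each $\mathscr{F}_k$ is a (possibly time-varying) deterministic (measurable) mapping, $x_o\in\mathbb{R}^{n_o}$ is the random initial state, $d$ is an exogenous random process with $d(k)\in\mathbb{R}^{n_d}$, $u$ is the plant input and $y$ the plant output. The samples of $u$ and $y$ may take values in arbitrary (measurable) sets. - Side information: $S_{\mathcal{E}}(k)$ is the side information used by the lossy encoder, $S_{\mathcal{D}}(k)$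 is the side information used by the reproduction decoder, and $S_{\mathrm{EC}}(k)$ is the common side information that becomes available at both the encoder and decoder sides at time $k$. These are random sequences taking values in arbitrary measurable spaces. The total side information at the encoder side and at the decoder side at time $k$ is $\mathcal{S}_{\mathcal{E}}(k)=(S_{\mathcal{E}}(k),S_{\mathrm{EC}}(k))$ and $\mathcal{S}_{\mathcal{D}}(k)=(S_{\mathcal{D}}(k),S_{\mathrm{EC}}(k))$, respectively. - Lossy encoder: $s(k)=\mathcal{E}_k(y^k,S_{\mathcal{E}}^k)\in\mathcal{A}_s$, where $\mathcal{A}_s$ is a fixed countable set. - Lossless (entropy) encoder and decoder: $s_c(k)=\mathcal{H}_k(s^k,S_{\mathrm{EC}}^k)\in\mathcal{A}(k)$, where $\mathcal{A}(k)$ is a countable set of prefix-free binary words, and $s(k)$ is recovered exactly as $s(k)=\mathcal{H}_k^{-1}(s_c^k,S_{\mathrm{EC}}^k)$. - Reproduction decoder: $u(k)=\mathcal{D}_k(s^k,S_{\mathcal{D}}^k)$. No invertibility of the decoder is assumed. All of $\mathcal{E}_k,\mathcal{H}_k,\mathcal{H}_k^{-1},\mathcal{D}_k$ are deterministic (measurable) mappings. $R(k)$ denotes the expected length of $s_c(k)$; it is a standard fact that the prefix-free and lossless-recovery properties imply $H(s(k)\mid s^{k-1},S_{\mathrm{EC}}^k)\le R(k)$, where $H(\cdot\mid\cdot)$ denotes conditional Shannon entropy. *)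

(* Defs.v *)
From HB Require Import structures.
From mathcomp Require Import all_boot all_order all_algebra.
From mathcomp Require Import all_classical all_reals all_analysis.

Set Implicit Arguments.
Unset Strict Implicit.
Unset Printing Implicit Defensive.

Import Order.TTheory GRing.Theory Num.Theory.
Import numFieldNormedType.Exports.

Local Open Scope classical_set_scope.
Local Open Scope ring_scope.
Local Open Scope ereal_scope.

Definition word := seq bool.
HB.instance Definition _ := Choice.on word.
HB.instance Definition _ := isPointed.Build word [::].
HB.instance Definition _ := @isMeasurable.Build default_measure_display
  word discrete_measurable discrete_measurable0
  discrete_measurableC discrete_measurableU.

Definition prefix_free (A : set word) : Prop :=
  forall a b : word, A a -> A b -> prefix a b -> a = b.

Section random_variables.
Context d (Omega : measurableType d) (R : realType) (P : probability Omega R).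

Section rv_pair.
Context d1 d2 (T1 : measurableType d1) (T2 : measurableType d2).
Variables (X : {RV P >-> T1}) (Y : {RV P >-> T2}).

Definition pair_fun (w : Omega) : T1 * T2 := (X w, Y w).

Let measurable_pair_fun : measurable_fun setT pair_fun.
Proof. by apply/measurable_fun_pairP; split; exact: measurable_funPT. Qed.

HB.instance Definition _ :=
  isMeasurableFun.Build _ _ _ _ pair_fun measurable_pair_fun.

Definition rv_pair : {RV P >-> (T1 * T2)%type} := pair_fun.

End rv_pair.

Section segment.
Context d1 (T : measurableType d1).
Variables (x : nat -> {RV P >-> T}) (m n : nat).

Definition segment_fun (w : Omega) : n.-tuple T := [tuple x (m + i)%N w | i < n].

Let measurable_segment_fun : measurable_fun setT segment_fun.
Proof.
apply/measurable_fun_tnthP => i.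
rewrite (_ : _ \o _ = x (m + i)%N); first exact: measurable_funPT.
by apply/funext => w /=; rewrite tnth_mktuple.
Qed.

HB.instance Definition _ :=
  isMeasurableFun.Build _ _ _ _ segment_fun measurable_segment_fun.

(* (x(m), ..., x(m + n - 1)) *)
Definition segment : {RV P >-> n.-tuple T} := segment_fun.

End segment.

(* (x(0), ..., x(n - 1)), i.e. x^{n-1}; thus x^k is [hist x k.+1] and x^{-1} is
   [hist x 0]. *)
Definition hist d1 (T : measurableType d1) (x : nat -> {RV P >-> T}) (n : nat) :
  {RV P >-> n.-tuple T} := segment x 0 n.

Definition expected_length (W : {RV P >-> word}) : \bar R :=
  \int[P]_w (size (W w))%:R%:E.

End random_variables.

Section conditioning.
Context d (Omega : measurableType d) (R : realType) (P : probability Omega R).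
Context d1 d2 d3 (T1 : measurableType d1) (T2 : measurableType d2)
  (T3 : measurableType d3).

Definition independent_rv (X : Omega -> T1) (Y : Omega -> T2) : Prop :=
  forall A B, measurable A -> measurable B ->
    P (X @^-1` A `&` Y @^-1` B) = P (X @^-1` A) * P (Y @^-1` B).

(* g is a version of z |-> P(E | Z = z). *)
Definition is_cond_prob (E : set Omega) (Z : Omega -> T3) (g : T3 -> R) : Prop :=
  [/\ measurable_fun setT g,
      (forall z, (0 <= g z)%R) &
      forall C, measurable C ->
        P (E `&` Z @^-1` C) = \int[P]_(w in Z @^-1` C) (g (Z w))%:E].

(* The Markov chain X <-> Z <-> Y: P(X in A, Y in B | Z) is almost surely
   P(X in A | Z) P(Y in B | Z).  Versions exist by Radon-Nikodym and are almost
   surely unique, so quantifying over all of them is harmless. *)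
Definition markov_chain (X : Omega -> T1) (Z : Omega -> T3) (Y : Omega -> T2) :
    Prop :=
  forall A B (gA gB : T3 -> R), measurable A -> measurable B ->
    is_cond_prob (X @^-1` A) Z gA -> is_cond_prob (Y @^-1` B) Z gB ->
    is_cond_prob (X @^-1` A `&` Y @^-1` B) Z (fun z => gA z * gB z)%R.

End conditioning.

(* The divergence int log2 (dmu/dnu) dmu, in bits.  The negative part of the
   integrand always has a finite integral. *)
Definition relative_entropy d (T : measurableType d) (R : realType)
    (mu nu : probability T R) : \bar R :=
  if `[< mu `<< nu >] then
    \int[mu]_t
      (ln (fine (Radon_Nikodym (charge_of_finite_measure mu) nu t)) / ln 2)%:E
  else +oo.

Section information.
Context d (Omega : measurableType d) (R : realType) (P : probability Omega R).

(* Q is the law on T1 * T2 * T3 that has the same (X, Z) and (Y, Z) marginals as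
   the law of (X, Y, Z) and makes the two first coordinates conditionally
   independent given the third.  There is at most one such Q. *)
Definition is_markov_coupling d1 d2 d3 (T1 : measurableType d1)
    (T2 : measurableType d2) (T3 : measurableType d3)
    (X : {RV P >-> T1}) (Y : {RV P >-> T2}) (Z : {RV P >-> T3})
    (Q : probability (T1 * T2 * T3)%type R) : Prop :=
  [/\ forall A, measurable A ->
        Q ((fun t => (t.1.1, t.2)) @^-1` A) = P (rv_pair X Z @^-1` A),
      forall A, measurable A ->
        Q ((fun t => (t.1.2, t.2)) @^-1` A) = P (rv_pair Y Z @^-1` A) &
      markov_chain Q (fun t => t.1.1) (fun t => t.2) (fun t => t.1.2)].

(* I(X; Y | Z) = int log2 (dm/dq) dm, where m is the law of (X, Y, Z) and q its
   Markov coupling.  The infimum is over a set with at most one element; it only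
   serves to return +oo when there is no coupling, which cannot occur over
   standard Borel spaces.  When Z is constant, q is the product of the marginals
   of X and Y (times the point mass of Z) and this is I(X; Y). *)
Definition cond_mutual_info d1 d2 d3 (T1 : measurableType d1)
    (T2 : measurableType d2) (T3 : measurableType d3)
    (X : {RV P >-> T1}) (Y : {RV P >-> T2}) (Z : {RV P >-> T3}) : \bar R :=
  ereal_inf [set relative_entropy (distribution P (rv_pair (rv_pair X Y) Z)) Q
            | Q in [set Q | is_markov_coupling X Y Z Q]].

(* I(y^k -> u^k) *)
Definition directed_info d1 d2 (TY : measurableType d1) (TU : measurableType d2)
    (y : nat -> {RV P >-> TY}) (u : nat -> {RV P >-> TU}) (k : nat) : \bar R :=
  \sum_(0 <= i < k.+1) cond_mutual_info (u i) (hist y i.+1) (hist u i).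

End information.

(* Main.v *)
(* Let X = (x_o, d^k), V_n = u^{n-1}, and let h_n(x, v) be the density of the law
   of (X, V_n) with respect to the product of its marginals, i.e. the density of
   P(X in dx | V_n = v) with respect to the law of X.  Since y^i is a function
   of (X, u^{i-1}), data processing gives
     I(u(i); y^i | u^{i-1}) <= E log2 (h_{i+1}(X, V_{i+1}) / h_i(X, V_i)),
   and the sum telescopes to E log2 h_{k+1}(X, V_{k+1}).  Given the decoder side
   information S, u^k is a function of the code words w = s_c^k, and S is
   independent of X, so E [h_{k+1}(X, V_{k+1}) 2^{-|w|}] is at most the Kraft sum,
   which is at most 1; with ln t <= t - 1 this bounds E log2 h_{k+1} by E |w|.
   The density h_n exists because conditioning on the countably many values of
   s_c^{n-1} costs at most their probability; h_n also provides the conditional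
   law of X given V_n, hence the Markov couplings, over arbitrary measurable
   spaces. *)

Require Import Defs.
From HB Require Import structures.
From mathcomp Require Import all_boot all_order all_algebra.
From mathcomp Require Import all_classical all_reals all_analysis.
From mathcomp Require Import measurable_realfun lra.

Set Implicit Arguments.
Unset Strict Implicit.
Unset Printing Implicit Defensive.

Import Order.TTheory GRing.Theory Num.Theory.
Import numFieldNormedType.Exports.

Local Open Scope classical_set_scope.
Local Open Scope ring_scope.
Local Open Scope ereal_scope.

(** * Integrals *)

(** The density [p] and the Radon-Nikodym derivative have equal integrals over every measurable set,
    so they agree [mu]-almost everywhere, and the change of variables known for the latter carries
    over to [p]. *)
Lemma ge0_integral_density d (T : measurableType d) (R : realType)
    (mu : {sigma_finite_measure set T -> \bar R})
    (nu : {finite_measure set T -> \bar R}) (p : T -> R) :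
    measurable_fun [set: T] p -> (forall t, (0 <= p t)%R) ->
    (forall A, measurable A -> nu A = \int[mu]_(t in A) (p t)%:E) ->
  forall (f : T -> \bar R) (A : set T), measurable A ->
    measurable_fun [set: T] f -> (forall t, 0 <= f t) ->
  \int[nu]_(t in A) f t = \int[mu]_(t in A) (f t * (p t)%:E).
Proof.
move=> mp p0 nuE f A mA mf f0.
have mEp : measurable_fun [set: T] (EFin \o p) by exact/measurable_EFinP.
have dom : nu `<< mu.
  apply/null_content_dominatesP => B mB B0; rewrite nuE//.
  by rewrite null_set_integral//; exact: measurable_funTS.
have ip : mu.-integrable setT (EFin \o p).
  apply/integrableP; split => //=.
  under eq_integral do rewrite ger0_norm//.
  by rewrite -nuE// -ge0_fin_numE ?fin_num_measure.
have ae_p : ae_eq mu setT (EFin \o p) (Radon_Nikodym_SigmaFinite.f nu mu).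
  apply: integral_ae_eq => //.
    exact: measurable_int (Radon_Nikodym_SigmaFinite.f_integrable _).
  move=> B _ mB; rewrite -Radon_Nikodym_SigmaFinite.f_integral//.
  by rewrite nuE.
have mRN : measurable_fun [set: T] (Radon_Nikodym_SigmaFinite.f nu mu).
  exact: measurable_int (Radon_Nikodym_SigmaFinite.f_integrable _).
rewrite -(Radon_Nikodym_SigmaFinite.change_of_variables dom f0 mA)//; last first.
  exact: measurable_funTS.
apply: ge0_ae_eq_integral => //.
- by apply: measurable_funTS; exact: emeasurable_funM.
- by apply: measurable_funTS; exact: emeasurable_funM.
- by move=> t _; apply: mule_ge0 => //; exact: Radon_Nikodym_SigmaFinite.f_ge0.
- by move=> t _; rewrite mule_ge0// lee_fin.
- apply: ae_eqe_mul2l; apply: ae_eq_sym.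
  by apply: ae_eq_subset ae_p.
Qed.

(** Positive and negative parts are transported separately, so measurability suffices. Log-densities
    are signed, and their integrability may not be known yet when this is applied. *)
Lemma integral_pushforward_measurable d1 d2 (T1 : measurableType d1)
    (T2 : measurableType d2) (R : realType) (mu : {measure set T1 -> \bar R})
    (phi : T1 -> T2) (f : T2 -> \bar R) :
    measurable_fun [set: T1] phi -> measurable_fun [set: T2] f ->
  \int[pushforward mu phi]_t f t = \int[mu]_t f (phi t).
Proof.
move=> mphi mf.
have mfp : measurable_fun [set: T2] f^\+ by exact: measurable_funepos.
have mfn : measurable_fun [set: T2] f^\- by exact: measurable_funeneg.
rewrite [RHS](_ : _ = \int[mu]_t (f \o phi) t)//.
rewrite [LHS]integralE [RHS]integralE (funepos_comp f phi) (funeneg_comp f phi).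
by congr (_ - _); rewrite (ge0_integral_pushforward mphi _ measurableT).
Qed.

Section integral_bounds.
Context d (T : measurableType d) (R : realType) (m : probability T R).
Implicit Types f g r : T -> R.

(** Almost everywhere the positive part of [f] is below that of [g] and the negative part above,
    which orders the two differences even when [f] is not integrable. *)
Lemma ae_le_integral_integrable f g :
    measurable_fun [set: T] f -> m.-integrable setT (EFin \o g) ->
    {ae m, forall t, (f t <= g t)%R} ->
  \int[m]_t (f t)%:E <= \int[m]_t (g t)%:E.
Proof.
move=> mf ig fg.
have mf' : measurable_fun [set: T] (EFin \o f) by exact/measurable_EFinP.
have mg' : measurable_fun [set: T] (EFin \o g) by exact: measurable_int ig.
rewrite integralE [leRHS]integralE leeB//.
- apply: ae_ge0_le_integral => //; [exact: measurable_funepos..|].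
  apply: filterS fg => t fgt _; rewrite !funeposE/=.
  by rewrite ge_max le_max lee_fin fgt/= le_max lexx orbT.
- apply: ae_ge0_le_integral => //; [exact: measurable_funeneg..|].
  apply: filterS fg => t fgt _; rewrite !funenegE/=.
  by rewrite ge_max !le_max lee_fin lerN2 fgt/= lexx orbT.
Qed.

Lemma ae_sandwich_integrable f g1 g2 : measurable_fun [set: T] f ->
    m.-integrable setT (EFin \o g1) -> m.-integrable setT (EFin \o g2) ->
    {ae m, forall t, (g1 t <= f t <= g2 t)%R} ->
  m.-integrable setT (EFin \o f).
Proof.
move=> mf i1 i2 gfg.
have mf' : measurable_fun [set: T] (EFin \o f) by exact/measurable_EFinP.
have /integrableP[m12 fin12] := integrableD measurableT (integrable_abse i1)
  (integrable_abse i2).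
apply/integrableP; split => //; apply: le_lt_trans fin12.
apply: ae_ge0_le_integral => //.
- exact: measurableT_comp.
- exact: measurableT_comp.
apply: filterS gfg => t /andP[ft1 ft2] _ /=.
rewrite lee_fin (ger0_norm (addr_ge0 _ _))// ler_norml.
rewrite (le_trans _ ft1) ?(le_trans ft2)//.
- by rewrite (le_trans (ler_norm _))// lerDr.
- rewrite lerNl (le_trans (ler_norm _))// normrN lerDl//.
Qed.

(** This is how [ln t <= t - 1] gets integrated: the correction [r - 1] has nonpositive integral. *)
Lemma integral_addB1_le g r :
    measurable_fun [set: T] r -> (forall t, (0 <= r t)%R) ->
    m.-integrable setT (EFin \o g) -> \int[m]_t (r t)%:E <= 1 ->
  m.-integrable setT (EFin \o (fun t => g t + r t - 1)%R) /\
  \int[m]_t (g t + r t - 1)%:E <= \int[m]_t (g t)%:E.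
Proof.
move=> mr r0 ig r1.
have mr' : measurable_fun [set: T] (EFin \o r) by exact/measurable_EFinP.
have ir : m.-integrable setT (EFin \o r).
  apply/integrableP; split => //=.
  under eq_integral do rewrite ger0_norm//.
  by rewrite (le_lt_trans r1)// ltry.
have i1 : m.-integrable setT (EFin \o cst 1%R).
  exact: finite_measure_integrable_cst.
have igr := integrableD measurableT ig ir.
split; first by apply: eq_integrable (integrableB measurableT igr i1).
under eq_integral do rewrite EFinB EFinD.
rewrite [leLHS](integralB measurableT igr i1)/=.
rewrite (integralD measurableT ig ir)/= integral_cst//=.
rewrite [X in _ - X]mul1e probability_setT.
by rewrite leeBlDr ?leeD2l// fin_num_abs.
Qed.

End integral_bounds.

(** * Data processing for relative entropy *)

Lemma ln_le_subr1 (R : realType) (x : R) : (0 < x)%R -> (ln x <= x - 1)%R.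
Proof.
by move=> x0; rewrite -[in ln _](subrKC 1%R x) le_ln1Dx// ltrBrDl subrr.
Qed.

Lemma measurable_fun_ge0_inv d (T : measurableType d) (R : realType)
    (p : T -> R) : measurable_fun [set: T] p -> (forall t, (0 <= p t)%R) ->
  measurable_fun [set: T] (fun t => (p t)^-1)%R.
Proof.
(* On nonnegative reals, 0 included, the inverse is the power with exponent -1, whose measurability
   is known. *)
move=> mp p0; rewrite (_ : (fun t => _) = (fun t => p t `^ (-1))%R).
  exact: (measurableT_comp (measurable_powR (-1)%R) mp).
by apply/funext => t; rewrite powR_inv1.
Qed.

(** The set where [p] vanishes has [nu]-mass equal to the integral of 0. *)
Lemma ae_density_gt0 d (T : measurableType d) (R : realType)
    (mu nu : {measure set T -> \bar R}) (p : T -> R) :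
    measurable_fun [set: T] p -> (forall t, (0 <= p t)%R) ->
    (forall A, measurable A -> nu A = \int[mu]_(t in A) (p t)%:E) ->
  {ae nu, forall t, (0 < p t)%R}.
Proof.
move=> mp p0 nuE.
have mp0 : measurable (p @^-1` [set 0%R]).
  by rewrite -[X in measurable X]setTI; exact: mp.
exists (p @^-1` [set 0%R]); split => //.
  by rewrite nuE// integral0_eq// => t /= ->.
by move=> t /= /negP; rewrite lt0r p0 andbT negbK => /eqP.
Qed.

Lemma ae_preimage d1 d2 (T1 : measurableType d1) (T2 : measurableType d2)
    (R : realType) (mu : {measure set T1 -> \bar R})
    (nu : {measure set T2 -> \bar R}) (phi : T1 -> T2) (Q : set T2) :
    measurable_fun [set: T1] phi ->
    (forall A, measurable A -> nu A = mu (phi @^-1` A)) ->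
  {ae nu, forall t, Q t} -> {ae mu, forall t, Q (phi t)}.
Proof.
move=> mphi nuE [N [mN N0 QN]]; exists (phi @^-1` N); split.
- by rewrite -[X in measurable X]setTI; exact: mphi.
- by rewrite -nuE.
- by move=> t /= nQ; exact: QN.
Qed.

Section data_processing.
Context d1 d2 (Z : measurableType d1) (T : measurableType d2) (R : realType).
Variables (lam : {sigma_finite_measure set Z -> \bar R}).
Variables (m0 n0 : probability Z R) (m n : probability T R).
Variables (p q : Z -> R) (psi : Z -> T).
Hypotheses (mp : measurable_fun [set: Z] p) (mq : measurable_fun [set: Z] q).
Hypotheses (p0 : forall z, (0 <= p z)%R) (q0 : forall z, (0 <= q z)%R).
Hypothesis m0E :
  forall A, measurable A -> m0 A = \int[lam]_(z in A) (p z)%:E.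
Hypothesis n0E :
  forall A, measurable A -> n0 A = \int[lam]_(z in A) (q z)%:E.
Hypothesis mpsi : measurable_fun [set: Z] psi.
Hypothesis mE : forall A, measurable A -> m A = m0 (psi @^-1` A).
Hypothesis nE : forall A, measurable A -> n A = n0 (psi @^-1` A).
Hypothesis q_gt0 : {ae m0, forall z, (0 < q z)%R}.
Hypothesis int_pq :
  m0.-integrable [set: Z] (EFin \o (fun z => ln (p z) - ln (q z))%R).

Let measurable_psi A : measurable A -> measurable (psi @^-1` A).
Proof. by move=> mA; rewrite -[X in measurable X]setTI; exact: mpsi. Qed.

(** If [n0 B = 0] then [q] vanishes [lam]-almost everywhere on [B]. Thus [B] is covered by a
    [lam]-null set, which is [m0]-null, and by the [m0]-null set where [q] is not positive. *)
Let m0n0 B : measurable B -> n0 B = 0 -> m0 B = 0.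
Proof.
move=> mB n0B.
have : \int[lam]_(z in B) `|(q z)%:E| = 0.
  by under eq_integral do rewrite /= ger0_norm//; rewrite -n0E.
move/ae_eq_integral_abs => -/(_ mB) [].
  by apply: measurable_funTS; exact/measurable_EFinP.
move=> N [mN N0 BN].
have m0N : m0 N = 0.
  rewrite m0E// null_set_integral//.
  by apply: measurable_funTS; exact/measurable_EFinP.
case: q_gt0 => N' [mN' N'0 qN'].
apply/eqP; rewrite eq_le measure_ge0 andbT.
rewrite (@le_trans _ _ (m0 (N `|` N')))//.
  rewrite le_measure ?inE//; first exact: measurableU.
  move=> z Bz; have [qz|qz] := eqVneq (q z) 0%R.
    by right; apply: qN' => /=; rewrite qz ltxx.
  by left; apply: BN => /= /(_ Bz) [] /eqP; exact/negP.
have -> : 0 = m0 N + m0 N' by rewrite m0N N'0 adde0.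
exact: measureU2.
Qed.

(** Data processing: the right side is the divergence of [m0] from [n0] in bits, the left side that
    of their images under [psi]. The proof compares densities pointwise and uses no disintegration
    along [psi], so the spaces can be arbitrary. *)
Lemma relative_entropy_pushforward_le :
  relative_entropy m n <=
  (\int[m0]_z (ln (p z) - ln (q z))%:E) * ((ln 2)^-1)%:E.
Proof.
have mn : m `<< n.
  apply/null_content_dominatesP => A mA nA0; rewrite mE//.
  by apply: m0n0; [exact: measurable_psi|rewrite -nE].
rewrite /relative_entropy asboolT//.
have ln2 : (0 < ln 2 :> R)%R by rewrite ln_gt0// ltr1n.
pose s t := fine (Radon_Nikodym_SigmaFinite.f m n t).
have s0 t : (0 <= s t)%R by exact/fine_ge0/Radon_Nikodym_SigmaFinite.f_ge0.
have sE t : (s t)%:E = Radon_Nikodym_SigmaFinite.f m n t.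
  by rewrite fineK// Radon_Nikodym_SigmaFinite.f_fin_num.
have ms' : measurable_fun [set: T] (Radon_Nikodym_SigmaFinite.f m n).
  exact: measurable_int (Radon_Nikodym_SigmaFinite.f_integrable _).
have ms : measurable_fun [set: T] s by exact: measurableT_comp.
have msE A : measurable A -> m A = \int[n]_(t in A) (s t)%:E.
  move=> mA; rewrite (Radon_Nikodym_SigmaFinite.f_integral mn mA).
  by apply: eq_integral => t _; rewrite sE.
have mRN : measurable_fun [set: T]
    (Radon_Nikodym (charge_of_finite_measure m) n).
  apply: measurable_int (Radon_Nikodym_integrable _).
  exact: mn.
(* The definition of [relative_entropy] uses the derivative of a charge; it agrees almost everywhere
   with [s], which is nonnegative everywhere. *)
rewrite [leLHS](_ : _ = \int[m]_t (ln (s t) / ln 2)%:E); last first.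
  apply: ae_eq_integral => //.
  - apply/measurable_EFinP; apply: measurable_funM => //.
    by do 2 apply: measurableT_comp => //.
  - apply/measurable_EFinP; apply: measurable_funM => //.
    exact: measurableT_comp.
  - have : ae_eq m setT (Radon_Nikodym_SigmaFinite.f m n)
        (Radon_Nikodym (charge_of_finite_measure m) n).
      apply: null_dominates_ae_eq => //; first exact: mn.
      exact: ae_eq_Radon_Nikodym_SigmaFinite.
    by apply: filterS => t /(_ I) E _; rewrite /s E.
have mlns : measurable_fun [set: T] (fun t => ln (s t) / ln 2)%R.
  by apply: measurable_funM => //; exact: measurableT_comp.
rewrite (eq_measure_integral (pushforward m0 psi)); last first.
  by move=> A mA _; exact: mE.
rewrite integral_pushforward_measurable//; last exact/measurable_EFinP.
(* With s = dm/dn, integrate ln s <= ln (p / q) + r - 1, which is ln t <= t - 1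
   at t = r; the integral of r under m0 is at most 1. *)
pose r z := (q z * s (psi z) / p z)%R.
have mspsi : measurable_fun [set: Z] (s \o psi) by exact: measurableT_comp.
have mr : measurable_fun [set: Z] r.
  apply: measurable_funM; first exact: measurable_funM.
  exact: measurable_fun_ge0_inv.
have r0 z : (0 <= r z)%R by rewrite divr_ge0// mulr_ge0.
have r1 : \int[m0]_z (r z)%:E <= 1.
  rewrite (ge0_integral_density mp p0 m0E)//; last exact/measurable_EFinP.
  (* Only an inequality holds here: where [p z = 0], division by zero returns 0 and the left
     integrand vanishes. *)
  apply: (@le_trans _ _ (\int[lam]_z ((s (psi z))%:E * (q z)%:E))).
    apply: ge0_le_integral => //.
    - by move=> z _; rewrite -EFinM lee_fin mulr_ge0.
    - by apply: emeasurable_funM; exact/measurable_EFinP.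
    - by apply: emeasurable_funM; exact/measurable_EFinP.
    - move=> z _; rewrite -!EFinM lee_fin /r.
      have [->|pz] := eqVneq (p z) 0%R; first by rewrite mulr0 mulr_ge0.
      by rewrite divfK// mulrC.
  rewrite -(ge0_integral_density mq q0 n0E measurableT
    (f := fun z => (s (psi z))%:E))//; last 2 first.
  - exact/measurable_EFinP.
  - by move=> t; rewrite lee_fin.
  rewrite -(integral_pushforward_measurable n0 (f := EFin \o s) mpsi)//;
    last exact/measurable_EFinP.
  rewrite (eq_measure_integral n); last by move=> A mA _; exact/esym/nE.
  by rewrite /= -msE// probability_setT.
have [ig leg] := integral_addB1_le mr r0 int_pq r1.
apply: (@le_trans _ _ (\int[m0]_z
    ((ln (p z) - ln (q z) + r z - 1) / ln 2)%:E)); last first.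
  under eq_integral do rewrite EFinM.
  by rewrite integralZr// lee_wpmul2r// lee_fin invr_ge0 ltW.
apply: ae_le_integral_integrable.
- exact: (@measurableT_comp _ _ _ _ _ _ (fun t => ln (s t) / ln 2)%R).
- by apply: eq_integrable (integrableZr measurableT (ln 2)^-1 ig).
apply: filterS3 (ae_density_gt0 mp p0 m0E) q_gt0
  (ae_preimage mpsi mE (ae_density_gt0 ms s0 msE)) => z pz qz sz.
rewrite ler_pM2r ?invr_gt0//.
have rz : (0 < r z)%R by rewrite divr_gt0// mulr_gt0.
have := ln_le_subr1 rz; rewrite /r ln_div ?posrE ?mulr_gt0// lnM ?posrE//.
lra.
Qed.

End data_processing.

(** * Conditional densities *)

Section product_probability.
Context d1 d2 (T1 : measurableType d1) (T2 : measurableType d2) (R : realType).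
Variables (mu1 : probability T1 R) (mu2 : probability T2 R).

Let product_setT : (mu1 \x mu2) [set: T1 * T2] = 1.
Proof.
rewrite -setXTT product_measure1E// -[RHS]mule1.
by congr (_ * _); exact: probability_setT.
Qed.

HB.instance Definition _ :=
  Measure_isProbability.Build _ _ _ (mu1 \x mu2) product_setT.

Definition product_probability : probability (T1 * T2)%type R := mu1 \x mu2.

Lemma product_probabilityE A B : measurable A -> measurable B ->
  product_probability (A `*` B) = mu1 A * mu2 B.
Proof. exact: product_measure1E. Qed.

Lemma product_probability_unique (m : probability (T1 * T2)%type R) :
    (forall A B, measurable A -> measurable B -> m (A `*` B) = mu1 A * mu2 B) ->
  forall A, measurable A -> m A = product_probability A.
Proof.
move=> mE A mA; apply/esym.
exact: (@product_measure_unique _ _ _ _ _ mu1 mu2).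
Qed.

Lemma measurable_fun_integral1 (f : T1 * T2 -> \bar R) :
    measurable_fun [set: T1 * T2] f -> (forall t, 0 <= f t) ->
  measurable_fun [set: T2] (fun y => \int[mu1]_x f (x, y)).
Proof. by move=> mf f0; exact: measurable_fun_fubini_tonelli_G. Qed.

Lemma integral_product_probability (f : T1 * T2 -> \bar R) :
    measurable_fun [set: T1 * T2] f -> (forall t, 0 <= f t) ->
  \int[product_probability]_t f t = \int[mu2]_y \int[mu1]_x f (x, y).
Proof. by move=> mf f0; exact: (@fubini_tonelli2 _ _ _ _ _ mu1 mu2). Qed.

Lemma integral_product_probability_setTX (f : T1 * T2 -> \bar R) B :
    measurable B -> measurable_fun [set: T1 * T2] f -> (forall t, 0 <= f t) ->
  \int[product_probability]_(t in [set: T1] `*` B) f t =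
  \int[mu2]_(y in B) \int[mu1]_x f (x, y).
Proof.
move=> mB mf f0; have mTB : measurable ([set: T1] `*` B) by exact: measurableX.
rewrite integral_mkcond integral_product_probability; last 2 first.
- by apply/(measurable_restrictT _ mTB)/measurable_funTS.
- by move=> t; rewrite patchE; case: ifPn.
rewrite [RHS]integral_mkcond; apply: eq_integral => y _.
rewrite patchE; case: ifPn => yB.
  apply: eq_integral => x _; rewrite patchE ifT// inE; split => //.
  exact/set_mem.
apply: integral0_eq => x _; rewrite patchE ifF//; apply/negbTE.
by apply: contra yB; rewrite !inE => -[].
Qed.

End product_probability.

Section conditional_density.
Context d (Omega : measurableType d) (R : realType) (P : probability Omega R).
Context d1 d2 (TX : measurableType d1) (TV : measurableType d2).
Variables (X : {RV P >-> TX}) (V : {RV P >-> TV}).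

(* h(., v) is the density of P(X in dx | V = v) with respect to the law of X; its
   integral is required to be 1 for every v, not only for almost every v. *)
Definition is_cond_density (h : TX * TV -> R) : Prop :=
  [/\ measurable_fun [set: TX * TV] h,
      forall t, (0 <= h t)%R,
      forall v, \int[distribution P X]_x (h (x, v))%:E = 1 &
      forall A, measurable A -> distribution P (rv_pair X V) A =
        \int[product_probability (distribution P X) (distribution P V)]_(t in A)
          (h t)%:E].

(** The Radon-Nikodym derivative has slices of integral 1 only for almost every [v]; modifying it
    over a null set of values [v] gives integral 1 for all of them. *)
Lemma cond_density_exists :
  distribution P (rv_pair X V) `<<
    product_probability (distribution P X) (distribution P V) ->
  exists h, is_cond_density h.
Proof.
move=> dom.
have [f [f0 ffin /integrableP[mf _] fE]] := radon_nikodym_sigma_finite dom.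
pose G v := \int[distribution P X]_x f (x, v).
have mG : measurable_fun [set: TV] G.
  exact: measurable_fun_integral1.
(* Over any measurable [B] both functions integrate to the probability that [V] lies in [B]. *)
have G1 : ae_eq (distribution P V) setT (cst 1) G.
  apply: integral_ae_eq => //.
    exact: finite_measure_integrable_cst.
  move=> B _ mB; rewrite integral_cst// mul1e.
  have mTB : measurable ([set: TX] `*` B) by exact: measurableX.
  transitivity (distribution P (rv_pair X V) ([set: TX] `*` B)).
    by congr (P _); apply/seteqP; split => w //= [].
  by rewrite fE// integral_product_probability_setTX.
have [N [mN N0 GN]] := G1.
(* Over the exceptional null set [N] the slice becomes the constant 1, itself a probability density
   for the law of [X]. *)
pose h t := if t.2 \in N then 1%R else fine (f t).
have mN2 : measurable_fun [set: TX * TV] (fun t => t.2 \in N).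
  apply: (measurable_fun_bool true).
  rewrite setTI (_ : _ @^-1` _ = snd @^-1` N).
    by rewrite -[X in measurable X]setTI; exact: measurable_snd.
  by apply/seteqP; split => t /=; [move/set_mem|move/mem_set].
have mh : measurable_fun [set: TX * TV] h.
  by apply: measurable_fun_ifT => //; exact: measurableT_comp.
exists h; split => //.
- by move=> t; rewrite /h; case: ifPn => // _; exact/fine_ge0.
- move=> v; have [vN|vN] := boolP (v \in N); rewrite /h/=.
    under eq_integral do rewrite vN.
    by rewrite integral_cst// mul1e; exact: probability_setT.
  under eq_integral do rewrite (negbTE vN) fineK//.
  apply: contrapT => Gv; move/negP : vN; apply; apply/mem_set/GN => /= /(_ I).
  by move/esym.
- move=> A mA; rewrite fE//.
  apply: ae_eq_integral => //.
  + exact: measurable_funTS.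
  + by apply: measurable_funTS; exact/measurable_EFinP.
  exists ([set: TX] `*` N); split; first exact: measurableX.
    apply: (eq_trans (product_probabilityE _ _ measurableT mN)).
    by rewrite [X in _ * X](N0 : distribution P V N = 0) mule0.
  move=> -[x v] /=; rewrite /h/= => xv; split => //; apply: contrapT => vN.
  apply: xv => _; rewrite ifF ?fineK//.
  by apply/negbTE; apply/negP => /set_mem.
Qed.

End conditional_density.

Lemma independent_rv_pairE d (Omega : measurableType d) (R : realType)
    (P : probability Omega R) d1 d2 (TX : measurableType d1)
    (TS : measurableType d2) (X : {RV P >-> TX}) (S : {RV P >-> TS}) :
    independent_rv P S X ->
  forall A, measurable A ->
    distribution P (rv_pair X S) A =
      product_probability (distribution P X) (distribution P S) A.
Proof.
move=> ind; apply: product_probability_unique => B C mB mC.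
rewrite /distribution /pushforward muleC -ind//.
by congr (P _); apply/seteqP; split => w [].
Qed.

Lemma integral_independent_rv d (Omega : measurableType d) (R : realType)
    (P : probability Omega R) d1 d2 (TX : measurableType d1)
    (TS : measurableType d2) (X : {RV P >-> TX}) (S : {RV P >-> TS})
    (f : TX * TS -> \bar R) :
    independent_rv P S X ->
    measurable_fun [set: TX * TS] f -> (forall t, 0 <= f t) ->
  \int[P]_w f (X w, S w) =
  \int[distribution P S]_s \int[distribution P X]_x f (x, s).
Proof.
move=> ind mf f0; rewrite -integral_product_probability//.
rewrite -(ge0_integral_distribution (rv_pair X S))//.
apply: eq_measure_integral => A mA _; exact: independent_rv_pairE.
Qed.

(** * Log-density and codeword length *)

Section coded_observation.
Context d (Omega : measurableType d) (R : realType) (P : probability Omega R).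
Context d1 d2 d3 (TX : measurableType d1) (TS : measurableType d2)
  (TV : measurableType d3) (C : countType).
Variables (X : {RV P >-> TX}) (S : {RV P >-> TS}) (V : {RV P >-> TV}).
Variables (W : Omega -> C) (delta : C -> TS -> TV).
Hypothesis indep : independent_rv P S X.
Hypothesis mW : forall a, measurable (W @^-1` [set a]).
Hypothesis mdelta : forall a, measurable_fun [set: TS] (delta a).
Hypothesis VE : forall w, V w = delta (W w) (S w).

(** Almost every slice of a product-null set [A] is null for the law of [X]. On each event [W = a]
    the observation is [delta a] of [S], and [S] is independent of [X], so Fubini makes that part of
    the event null. There are countably many values [a]. *)
Lemma coded_observation_dominates :
  distribution P (rv_pair X V) `<<
    product_probability (distribution P X) (distribution P V).
Proof.
apply/null_content_dominatesP => A mA A0.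
have m1A : measurable_fun [set: TX * TV] (fun t => (\1_A t)%:E : \bar R).
  by apply/measurable_EFinP.
pose k v := \int[distribution P X]_x (\1_A (x, v))%:E.
have k_ge0 v : 0 <= k v by apply: integral_ge0 => x _; rewrite lee_fin.
have mk : measurable_fun [set: TV] k.
  apply: (measurable_fun_integral1 (distribution P X) m1A) => t.
  by rewrite lee_fin.
have : \int[distribution P V]_v `|k v| = 0.
  under eq_integral do rewrite gee0_abs//.
  rewrite -(integral_product_probability _ _ m1A)//.
  by rewrite integral_indic// setIT.
move/ae_eq_integral_abs => -/(_ measurableT mk) [N [mN N0 kN]].
(* The part of [A] seen through [delta a], without the values in [N] whose slices may have positive
   mass. *)
pose B a := [set t : TX * TS | A (t.1, delta a t.2) /\ ~ N (delta a t.2)].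
have mdelta2 a : measurable_fun [set: TX * TS] (fun t => delta a t.2).
  exact: (measurableT_comp (mdelta a) measurable_snd).
have mpair d' (T : measurableType d') (t : T) :
    measurable_fun [set: TX] (fun x => (x, t)).
  exact: measurable_fun_pair.
have mB a : measurable (B a).
  apply: measurableI.
    rewrite -[X in measurable X]setTI.
    have : measurable_fun [set: TX * TS] (fun t => (t.1, delta a t.2)).
      by apply: measurable_fun_pair.
    exact.
  rewrite -[X in measurable X]setTI.
  exact: (mdelta2 a measurableT _ (measurableC mN)).
have B0 a : P (rv_pair X S @^-1` B a) = 0.
  have m1B : measurable_fun [set: TX * TS] (fun t => (\1_(B a) t)%:E : \bar R).
    by apply/measurable_EFinP.
  rewrite -[LHS]/(distribution P (rv_pair X S) (B a)) independent_rv_pairE//.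
  rewrite (_ : product_probability _ _ _ = \int[product_probability
    (distribution P X) (distribution P S)]_t (\1_(B a) t)%:E); last first.
    by rewrite integral_indic// setIT.
  rewrite integral_product_probability//.
  rewrite integral0_eq// => s _.
  have [Ns|Ns] := pselect (N (delta a s)).
    rewrite integral0_eq// => x _; rewrite indicE memNset// => -[_]; exact.
  have ks : k (delta a s) = 0.
    by apply: contrapT => ks; apply: Ns; apply: kN => /= /(_ I).
  apply/eqP; rewrite eq_le; apply/andP; split; last first.
    by apply: integral_ge0 => x _; rewrite lee_fin.
  rewrite -[leRHS]ks; apply: ge0_le_integral => //.
  - exact: (measurableT_comp m1B (mpair _ TS s)).
  - exact: (measurableT_comp m1A (mpair _ TV (delta a s))).
  - move=> x _; rewrite lee_fin !indicE ler_nat.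
    by case: (boolP (_ \in B a)) => // /set_mem[/mem_set ->].
(* The union is indexed by the codes of the values of [W]; a number that codes no value contributes
   the empty set. *)
pose F j := [set w | pickle (W w) = j /\ B (W w) (X w, S w)].
have Fneg : P.-negligible (\bigcup_j F j).
  apply: negligible_bigcup => j.
  have [[a aj]|ja] := pselect (exists a : C, pickle a = j).
    exists (rv_pair X S @^-1` B a); split; [|exact: B0|].
      exact: measurable_funPTI.
    move=> w /= [wj]; have -> // : W w = a.
    by apply: (pcan_inj pickleK); rewrite wj.
  apply: negligibleS (negligible_set0 P) => w /= [wj _].
  by apply: ja; exists (W w).
have Nneg : P.-negligible (V @^-1` N).
  exists (V @^-1` N); split; [|exact: N0|by []].
  exact: measurable_funPTI.
apply: (@measure_negligible _ _ _ P (rv_pair X V @^-1` A)).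
  exact: (measurable_funPTI (rv_pair X V)).
apply: negligibleS (negligibleU Nneg Fneg) => w /= Aw.
have [Nw|Nw] := pselect (N (V w)); [by left|right].
by exists (pickle (W w)) => //=; split => //; rewrite /B/= -VE.
Qed.

(** The type [C] carries no sigma-algebra. Every preimage is a countable union of preimages of
    singletons, so any function of [W] is a random variable. *)
Lemma measurable_preimage_countable (A : set C) : measurable (W @^-1` A).
Proof.
rewrite (_ : _ @^-1` _ = \bigcup_j [set w | A (W w) /\ pickle (W w) = j]).
  apply: bigcup_measurable => j _.
  have [[a [Aa aj]]|ja] := pselect (exists a, A a /\ pickle a = j).
    rewrite (_ : [set w | _] = W @^-1` [set a])//.
    apply/seteqP; split => w /=; last by move=> ->.
    by move=> [_]; rewrite -aj => /(pcan_inj pickleK).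
  rewrite (_ : [set w | _] = set0)//.
  by rewrite -subset0 => w /= wj; apply: ja; exists (W w).
by apply/seteqP; split => w /=; [exists (pickle (W w))|case=> j _ []].
Qed.

Lemma measurable_fun_countable d' (T : measurableType d') (f : C -> T) :
  measurable_fun [set: Omega] (f \o W).
Proof.
move=> _ A _; rewrite setTI.
exact: (measurable_preimage_countable (f @^-1` A)).
Qed.

Section coding_bound.
Variables (c : C -> R) (h : TX * TV -> R).
Hypothesis c_gt0 : forall a, (0 < c a)%R.
Hypothesis kraft : forall r : seq C, uniq r ->
  (forall a, a \in r -> exists w, W w = a) -> (\sum_(a <- r) c a <= 1)%R.
Hypothesis hP : is_cond_density X V h.
Hypothesis int_c :
  P.-integrable [set: Omega] (EFin \o (fun w => - ln (c (W w)))%R).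

Let mh : measurable_fun [set: TX * TV] h. Proof. by case: hP. Qed.
Let h0 t : (0 <= h t)%R. Proof. by case: hP. Qed.

Let mhXV : measurable_fun [set: Omega] (fun w => h (X w, V w)).
Proof. exact: (measurableT_comp mh (measurable_funPT (rv_pair X V))). Qed.

Let mc : measurable_fun [set: Omega] (fun w => c (W w)).
Proof. exact: measurable_fun_countable. Qed.

(* On {W = a} the observation V is a function of S, which is independent of X,
   so the conditional density integrates to at most 1 there. *)
Let integral_piece a :
  \int[P]_(w in W @^-1` [set a]) (h (X w, V w) * c (W w))%:E <= (c a)%:E.
Proof.
have mg : measurable_fun [set: TX * TS] (fun t => h (t.1, delta a t.2)).
  apply: measurableT_comp => //; apply: measurable_fun_pair => //.
  exact: (measurableT_comp (mdelta a) measurable_snd).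
have mgP : measurable_fun [set: Omega] (fun w => h (X w, delta a (S w))).
  exact: (measurableT_comp mg (measurable_funPT (rv_pair X S))).
apply: (@le_trans _ _ (\int[P]_w (h (X w, delta a (S w)) * c a)%:E)).
  rewrite (eq_integral (fun w => (h (X w, delta a (S w)) * c a)%:E)); last first.
    by move=> w /set_mem/= wa; rewrite VE wa.
  apply: ge0_subset_integral => //.
    by apply/measurable_EFinP; exact: measurable_funM.
  by move=> w _; rewrite lee_fin mulr_ge0// ltW.
have mgE : measurable_fun [set: TX * TS] (fun t => (h (t.1, delta a t.2))%:E).
  exact/measurable_EFinP.
have mgPE : measurable_fun [set: Omega] (fun w => (h (X w, delta a (S w)))%:E).
  exact/measurable_EFinP.
have ca0 : 0 <= (c a)%:E by rewrite lee_fin ltW.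
have g0 t : 0 <= (h (t.1, delta a t.2))%:E by rewrite lee_fin.
under eq_integral do rewrite EFinM.
rewrite ge0_integralZr//; last by move=> w _; rewrite lee_fin.
rewrite (integral_independent_rv indep mgE g0).
rewrite (eq_integral (cst 1)); last first.
  by case: hP => _ _ h1 _ s _; exact: (h1 (delta a s)).
by rewrite integral_cst// mul1e [X in X * _]probability_setT mul1e.
Qed.

(** Splitting over the values of [W] bounds each piece by [c a], and each partial sum is then a
    Kraft sum over a finite family. *)
Lemma integral_density_weight_le1 :
  \int[P]_w (h (X w, V w) * c (W w))%:E <= 1.
Proof.
pose F j := [set w | pickle (W w) = j].
have mF j : measurable (F j).
  exact: (measurable_preimage_countable [set a | pickle a = j]).
have UF : \bigcup_j F j = [set: Omega].
  by apply/seteqP; split => // w _; exists (pickle (W w)).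
have m1 : measurable_fun [set: Omega] (fun w => (h (X w, V w) * c (W w))%:E).
  by apply/measurable_EFinP; exact: measurable_funM.
have f0 w : 0 <= (h (X w, V w) * c (W w))%:E.
  by rewrite lee_fin mulr_ge0// ltW.
rewrite -UF ge0_integral_bigcup//; last 2 first.
- by rewrite UF.
- by move=> i j _ _ [w [<- <-]].
(* Decodes [j] only when that value is attained by [W], because [kraft] speaks of attained values
   only. *)
pose g j : option C :=
  if `[< exists w, pickle (W w) = j >] then pickle_inv j else None.
have gK : ocancel g pickle.
  by move=> j; rewrite /g; case: asboolP => //= _; exact: pickle_invK.
have gW a j : g j = Some a -> exists w, W w = a.
  rewrite /g; case: asboolP => // -[w <-]; rewrite pickleK_inv => -[<-].
  by exists w.
apply: lime_le.
  by apply: is_cvg_nneseries => j _ _; exact: integral_ge0.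
apply: nearW => m.
apply: (@le_trans _ _ (\sum_(0 <= j < m) (oapp c 0%R (g j))%:E)).
  apply: lee_sum => j _; rewrite /g; case: asboolP => [[w wj]|nw].
    rewrite -wj pickleK_inv/=; apply: le_trans (integral_piece (W w)).
    rewrite le_eqVlt; apply/orP; left; apply/eqP; congr (integral P _ _).
    apply/seteqP; split => w' /=; first by move/(pcan_inj pickleK).
    by move=> e; congr pickle.
  rewrite (_ : F j = set0) ?integral_set0//.
  by rewrite -subset0 => w wj; apply: nw; exists w.
rewrite sumEFin lee_fin.
rewrite (_ : (\sum_(0 <= j < m) _)%R =
    (\sum_(a <- pmap g (index_iota 0 m)) c a)%R); last first.
  by rewrite big_pmap; apply: eq_bigr => j _; case: (g j).
apply: kraft; first by rewrite (pmap_uniq gK)// iota_uniq.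
by move=> a; rewrite mem_pmap => /mapP[j _ /esym/gW].
Qed.

(** The integral of [ln h] is the mutual information of [X] and [V] in nats. The means of [h c] and
    of [1 / h] are at most 1, which gives the upper and the lower estimate; together they sandwich
    [ln h] and make it integrable. *)
Lemma log_density_bound :
  [/\ P.-integrable [set: Omega] (EFin \o (fun w => ln (h (X w, V w)))%R),
      0 <= \int[P]_w (ln (h (X w, V w)))%:E &
      \int[P]_w (ln (h (X w, V w)))%:E <= \int[P]_w (- ln (c (W w)))%:E].
Proof.
have hE A : measurable A -> distribution P (rv_pair X V) A =
    \int[product_probability (distribution P X) (distribution P V)]_(t in A)
      (h t)%:E by case: hP => _ _ _; exact.
have mlnh : measurable_fun [set: Omega] (fun w => ln (h (X w, V w))).
  exact: measurableT_comp.
have h_gt0 : {ae P, forall w, (0 < h (X w, V w))%R}.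
  apply: (ae_preimage (measurable_funPT (rv_pair X V)) _
    (ae_density_gt0 mh h0 hE)) => A mA //.
have mhc : measurable_fun [set: Omega] (fun w => h (X w, V w) * c (W w))%R.
  exact: measurable_funM.
have hc0 w : (0 <= h (X w, V w) * c (W w))%R by rewrite mulr_ge0// ltW.
have [ig leg] := integral_addB1_le mhc hc0 int_c integral_density_weight_le1.
(* ln t <= t - 1 at t = h c and, for the lower bound, at t = 1 / h. *)
have upper : {ae P, forall w, (ln (h (X w, V w)) <=
    - ln (c (W w)) + h (X w, V w) * c (W w) - 1)%R}.
  apply: filterS h_gt0 => w hw.
  have := ln_le_subr1 (mulr_gt0 hw (c_gt0 (W w))).
  by rewrite lnM ?posrE//; lra.
have mhinv : measurable_fun [set: Omega] (fun w => (h (X w, V w))^-1%R).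
  exact: measurable_fun_ge0_inv.
have hinv0 w : (0 <= (h (X w, V w))^-1)%R by rewrite invr_ge0.
(* Under the joint law the mean of [1 / h] is the product mass of the set where [h] is positive. *)
have hinv1 : \int[P]_w ((h (X w, V w))^-1)%:E <= 1.
  have mhi : measurable_fun [set: TX * TV] (fun t => ((h t)^-1)%:E).
    by apply/measurable_EFinP; exact: measurable_fun_ge0_inv.
  have hi0 t : 0 <= ((h t)^-1)%:E by rewrite lee_fin invr_ge0.
  rewrite -(ge0_integral_distribution (rv_pair X V)
    (f := fun t => ((h t)^-1)%:E))//.
  rewrite (ge0_integral_density mh h0 hE)//.
  apply: (@le_trans _ _ (\int[product_probability (distribution P X)
      (distribution P V)]_t (cst 1 t))).
    apply: ge0_le_integral => //.
    - by move=> t _; rewrite mule_ge0// lee_fin.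
    - by apply: emeasurable_funM => //; exact/measurable_EFinP.
    - move=> t _; rewrite -EFinM lee_fin.
      by have [->|ht] := eqVneq (h t) 0%R; rewrite ?mulr0// mulVf.
  by rewrite integral_cst// mul1e probability_le1.
have i0 : P.-integrable [set: Omega] (EFin \o cst 0%R).
  exact: finite_measure_integrable_cst.
have [ih _] := integral_addB1_le mhinv hinv0 i0 hinv1.
have lower : {ae P, forall w, (1 - (h (X w, V w))^-1 <= ln (h (X w, V w)))%R}.
  apply: filterS h_gt0 => w hw.
  have := @ln_le_subr1 _ (h (X w, V w))^-1%R.
  by rewrite invr_gt0 lnV ?posrE// => /(_ hw); rewrite lerNl opprB.
have iln : P.-integrable [set: Omega] (EFin \o (fun w => ln (h (X w, V w)))%R).
  apply: (@ae_sandwich_integrable _ _ _ P _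
    (fun w => - (cst 0 w + (h (X w, V w))^-1 - 1))%R _ mlnh _ ig).
    exact: integrableN ih.
  apply: filterS2 lower upper => w lw uw.
  by rewrite uw andbT add0r opprB.
split => //; last first.
  exact: le_trans (ae_le_integral_integrable mlnh ig upper) leg.
(* For nonnegativity, [ln h + 1 / h - 1] is almost surely nonnegative and its integral is at most
   that of [ln h]. *)
have [ilh lelh] := integral_addB1_le mhinv hinv0 iln hinv1.
apply: le_trans lelh.
rewrite -[leLHS](integral0 P [set: Omega]).
apply: (@ae_le_integral_integrable _ _ _ P (cst 0%R) _ _ ilh) => //.
apply: filterS lower => w; rewrite lerBlDr => lw.
by rewrite subr_ge0.
Qed.

End coding_bound.

End coded_observation.

(** * Kraft's inequality for words and for blocks of codewords *)

Lemma kraft_inequality (R : realType) (r : seq (seq bool)) : uniq r ->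
    {in r &, forall a b, prefix a b -> a = b} ->
  (\sum_(w <- r) 2^-1 ^+ size w <= 1 :> R)%R.
Proof.
have [N] := ubnP (\max_(w <- r) size w).
(* Induction on a strict bound [N] on the word lengths. If the empty word occurs, prefix-freeness
   makes it the only word. *)
elim: N r => [//|N IH] r rN ur pr.
have [nr|nr] := boolP ([::] \in r).
  have rE : perm_eq r [:: [::]].
    apply: uniq_perm => // w; rewrite inE; apply/idP/eqP => [wr|->//].
    by rewrite -(pr _ _ nr wr (prefix0s w)).
  by rewrite (perm_big _ rE)/= big_seq1.
(* Strips a leading bit [b] and rejects all other words. The sum for [r] is half the total of the
   sums for the two families of tails. *)
pose g b (w : seq bool) :=
  if w is c :: w' then if c == b then Some w' else None else None.
have gK b : ocancel (g b) (cons b).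
  by case=> [|c w]//=; case: eqP => //= ->.
have mem_g b w : w \in pmap (g b) r -> b :: w \in r.
  by rewrite mem_pmap => /mapP[[|c w']//= wr]; case: eqP => // <- [->].
have IHg b : (\sum_(w <- pmap (g b) r) 2^-1 ^+ size w <= 1 :> R)%R.
  (* The empty family is treated apart because its maximal length is 0, which need not be below
     [N]. *)
  have [->|] := eqVneq (pmap (g b) r) [::]; first by rewrite big_nil.
  case E : (pmap _ r) => [//|w0 r0] _; rewrite -E; apply: IH.
  - have : forall w, w \in pmap (g b) r -> (size w < N)%N.
      move=> w /mem_g wr; rewrite -ltnS; apply: leq_trans rN.
      by rewrite ltnS; exact: (leq_bigmax_seq _ wr).
    move=> bound; rewrite big_seq.
    have w0r : w0 \in pmap (g b) r by rewrite E mem_head.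
    elim/big_ind : _ => [|m n mN nN|]; last exact: bound.
      exact: leq_ltn_trans (leq0n _) (bound _ w0r).
    by rewrite gtn_max mN.
  - by rewrite (pmap_uniq (gK b)).
  - move=> w w' /mem_g wr /mem_g wr' ww'.
    have := pr _ _ wr wr'; rewrite /= eqxx ww' => /(_ isT).
    by case.
have -> : (\sum_(w <- r) 2^-1 ^+ size w =
    2^-1 * (\sum_(w <- pmap (g true) r) 2^-1 ^+ size w
            + \sum_(w <- pmap (g false) r) 2^-1 ^+ size w) :> R)%R.
  rewrite !big_pmap -big_split/= big_distrr/= big_seq [RHS]big_seq.
  apply: eq_bigr => -[|[] w] wr /=; first by rewrite wr in nr.
    by rewrite addr0 exprS.
  by rewrite add0r exprS.
have := IHg true; have := IHg false; lra.
Qed.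

(** Unique parsing: of the two first words one is a prefix of the other, so they coincide. Removing
    them shifts the family [A] by one time step. *)
Lemma prefix_flatten_eq (A : nat -> set word) (a b : seq word) :
    (forall i, prefix_free (A i)) -> size a = size b ->
    (forall i, (i < size a)%N -> A i (nth [::] a i)) ->
    (forall i, (i < size b)%N -> A i (nth [::] b i)) ->
  prefix (flatten a) (flatten b) -> a = b.
Proof.
move=> pA; elim: a b A pA => [|a0 a IH] [|b0 b]// A pA [sab] Aa Ab.
move=> /prefixP[t /= E].
have a0E : take (size a0) (b0 ++ flatten b) = a0.
  by rewrite E -catA take_size_cat.
have a0b0 : a0 = b0.
  have Aa0 := Aa 0%N isT; have Ab0 := Ab 0%N isT.
  have [le|/ltnW le] := leqP (size a0) (size b0).
    apply: (pA 0%N) => //.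
    by rewrite prefixE -[in X in _ == X]a0E takel_cat.
  apply/esym/(pA 0%N) => //.
  by rewrite prefixE -{1}a0E take_takel// take_size_cat.
move: E; rewrite a0b0 -catA => /eqP.
rewrite eqseq_cat// eqxx/= => /eqP E.
congr cons; apply: (IH b (fun i => A i.+1)) => //.
- by move=> i; exact: (Aa i.+1).
- by move=> i; exact: (Ab i.+1).
- by rewrite E prefix_prefix.
Qed.

(** Concatenation is injective on [r] with prefix-free image, so Kraft's inequality for single words
    applies to whole blocks. *)
Lemma kraft_inequality_tuple (R : realType) (A : nat -> set word) n
    (r : seq (n.-tuple (seq bool))) :
    (forall i, prefix_free (A i)) -> uniq r ->
    (forall a, a \in r -> forall i : 'I_n, A i (tnth a i)) ->
  (\sum_(a <- r) 2^-1 ^+ size (flatten a) <= 1 :> R)%R.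
Proof.
move=> pA ur Ar.
have inj : {in r &, forall a b : n.-tuple (seq bool),
    prefix (flatten a) (flatten b) -> a = b}.
  have Anth (a : n.-tuple (seq bool)) : a \in r ->
      forall i, (i < size a)%N -> A i (nth [::] a i).
    move=> ar i; rewrite size_tuple => ilt.
    by have := Ar _ ar (Ordinal ilt); rewrite (tnth_nth [::]).
  move=> a b ar br ab; apply/val_inj/(prefix_flatten_eq pA) => //.
  - by rewrite !size_tuple.
  - exact: Anth.
  - exact: Anth.
rewrite -(big_map (fun a : n.-tuple (seq bool) => flatten a) xpredT
  (fun w => 2^-1 ^+ size w)%R).
apply: kraft_inequality.
  rewrite map_inj_in_uniq// => a b ar br ab; apply: inj => //.
  by rewrite ab prefix_refl.
move=> _ _ /mapP[a ar ->] /mapP[b br ->] ab.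
by rewrite (inj a b).
Qed.

(** * Markov couplings *)

Section density_measure.
Context d (T : measurableType d) (R : realType).
Variables (mu : {measure set T -> \bar R}) (q : T -> R).
Hypotheses (mq : measurable_fun [set: T] q) (q0 : forall t, (0 <= q t)%R).

Let nu A : \bar R := \int[mu]_(t in A) (q t)%:E.

Let nu0 : nu set0 = 0. Proof. exact: integral_set0. Qed.

Let nu_ge0 A : 0 <= nu A.
Proof. by apply: integral_ge0 => t _; rewrite lee_fin. Qed.

Let nu_sigma_additive : semi_sigma_additive nu.
Proof.
move=> F mF tF mUF; rewrite /nu ge0_integral_bigcup//; last 2 first.
- by apply/measurable_EFinP; exact: measurable_funTS.
- by move=> t _; rewrite lee_fin.
by apply: is_cvg_nneseries => n _ _; exact: nu_ge0.
Qed.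

Lemma density_finite_measure : \int[mu]_t (q t)%:E < +oo ->
  exists m : {finite_measure set T -> \bar R},
    forall A, m A = \int[mu]_(t in A) (q t)%:E.
Proof.
move=> q_oo.
pose B := isMeasure.Build _ _ _ nu nu0 nu_ge0 nu_sigma_additive.
pose m : {measure set T -> \bar R} := HB.pack nu B.
have fin_m : fin_num_fun m.
  move=> A mA; rewrite ge0_fin_numE//; apply: le_lt_trans q_oo.
  apply: ge0_subset_integral => //; first exact/measurable_EFinP.
  by move=> t _; rewrite lee_fin.
pose F := Measure_isFinite.Build _ _ _ m fin_m.
pose m' : {finite_measure set T -> \bar R} := HB.pack (Measure.sort m) F.
by exists m'.
Qed.

Lemma density_probability : \int[mu]_t (q t)%:E = 1 ->
  exists m : probability T R, forall A, m A = \int[mu]_(t in A) (q t)%:E.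
Proof.
move=> q1.
pose B := isMeasure.Build _ _ _ nu nu0 nu_ge0 nu_sigma_additive.
pose m : {measure set T -> \bar R} := HB.pack nu B.
pose F := Measure_isProbability.Build _ _ _ m q1.
pose m' : probability T R := HB.pack (Measure.sort m) F.
by exists m'.
Qed.

End density_measure.

(** The image under [V] of [P] restricted to [E] and the law of [V] weighted by [g] are the same
    measure; both sides integrate [f] against it. *)
Lemma integral_conditional_weight d d' (Omega : measurableType d)
    (T : measurableType d') (R : realType) (P : probability Omega R)
    (V : {RV P >-> T}) (E : set Omega) (g : T -> R) (f : T -> R) C :
    measurable E -> measurable C ->
    measurable_fun [set: T] g -> (forall v, (0 <= g v)%R) ->
    (forall C', measurable C' ->
      P (E `&` V @^-1` C') = \int[distribution P V]_(v in C') (g v)%:E) ->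
    measurable_fun [set: T] f -> (forall v, (0 <= f v)%R) ->
  \int[P]_(w in E `&` V @^-1` C) (f (V w))%:E =
  \int[distribution P V]_(v in C) (f v * g v)%:E.
Proof.
move=> mE mC mg g0 gE mf f0.
have m1E : measurable_fun [set: Omega] (\1_E : Omega -> R) by [].
have [|nu1 nu1E] := density_finite_measure (mu := P) m1E (fun _ => ler0n _ _).
  by rewrite integral_indic// setIT (le_lt_trans (probability_le1 P mE))// ltry.
have [|nu2 nu2E] := density_finite_measure (mu := distribution P V) mg g0.
  rewrite -gE// preimage_setT setIT.
  by rewrite (le_lt_trans (probability_le1 P mE))// ltry.
have mEf : measurable_fun [set: T] (EFin \o f) by exact/measurable_EFinP.
under [RHS]eq_integral do rewrite EFinM.
rewrite -(ge0_integral_density mg g0 (fun A _ => nu2E A) mC mEf)//.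
have nu12 A : measurable A -> nu2 A = pushforward nu1 V A.
  move=> mA; rewrite nu2E -gE// /pushforward nu1E integral_indic//.
  exact: measurable_funPTI.
rewrite (eq_measure_integral (pushforward nu1 V)); last first.
  by move=> A mA _; exact: nu12.
rewrite (ge0_integral_pushforward (measurable_funPT V) _ mC)//; last first.
- by move=> v _; rewrite lee_fin.
- exact: measurable_funTS.
have mfV : measurable_fun [set: Omega] ((EFin \o f) \o V).
  exact: measurableT_comp.
have mVC : measurable (V @^-1` C) by exact: measurable_funPTI.
have fV0 w : 0 <= ((EFin \o f) \o V) w by rewrite lee_fin.
apply/esym; apply: eq_trans (ge0_integral_density m1E (fun _ => ler0n _ _)
  (fun A _ => nu1E A) mVC mfV fV0) _.
rewrite [RHS]integral_mkcondl; apply: eq_integral => w _.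
by rewrite patchE indicE; case: ifPn => _; rewrite ?mule1 ?mule0.
Qed.

Section markov_coupling.
Context d (Omega : measurableType d) (R : realType) (P : probability Omega R).
Context d1 d2 d3 d4 d5 (TX : measurableType d1) (TV' : measurableType d2)
  (TV : measurableType d3) (TW : measurableType d4) (TY : measurableType d5).
Variables (X : {RV P >-> TX}) (V' : {RV P >-> TV'}).
Variables (U : {RV P >-> TW}) (Y : {RV P >-> TY}) (V : {RV P >-> TV}).
Variables (pi : TV' -> TV) (tau : TV' -> TW) (phi : TX * TV -> TY).
Hypotheses (mpi : measurable_fun [set: TV'] pi)
  (mtau : measurable_fun [set: TV'] tau)
  (mphi : measurable_fun [set: TX * TV] phi).
Hypotheses (VE : forall w, V w = pi (V' w)) (UE : forall w, U w = tau (V' w))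
  (YE : forall w, Y w = phi (X w, V w)).
Variable h : TX * TV -> R.
Hypothesis hP : is_cond_density X V h.

Let mh : measurable_fun [set: TX * TV] h. Proof. by case: hP. Qed.
Let h0 t : (0 <= h t)%R. Proof. by case: hP. Qed.

Let lam := product_probability (distribution P X) (distribution P V').
Let q (z : TX * TV') := h (z.1, pi z.2).
Let psi (z : TX * TV') := (tau z.2, phi (z.1, pi z.2), pi z.2).

Let mxpi : measurable_fun [set: TX * TV'] (fun z => (z.1, pi z.2)).
Proof.
apply: measurable_fun_pair => //; exact: (measurableT_comp mpi measurable_snd).
Qed.

Let mq : measurable_fun [set: TX * TV'] q.
Proof. exact: (measurableT_comp mh mxpi). Qed.

Let mpsi : measurable_fun [set: TX * TV'] psi.
Proof.
apply: measurable_fun_pair; last exact: (measurableT_comp mpi measurable_snd).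
apply: measurable_fun_pair; first exact: (measurableT_comp mtau measurable_snd).
exact: (measurableT_comp mphi mxpi).
Qed.

(** The conditional probability of [(X, V)] lying in [B] given [V = v], as a kernel built from
    [h]. *)
Let K (B : set (TX * TV)) v :=
  \int[distribution P X]_x ((\1_B (x, v) * h (x, v))%:E).

Let mK_aux B : measurable B ->
  measurable_fun [set: TX * TV] (fun t => (\1_B t * h t)%:E).
Proof.
move=> mB; apply/measurable_EFinP; exact: measurable_funM.
Qed.

Let K_ge0_aux B t : 0 <= (\1_B t * h t)%:E.
Proof. by rewrite lee_fin mulr_ge0. Qed.

Let mK B : measurable B -> measurable_fun [set: TV] (K B).
Proof.
by move=> mB; exact: (measurable_fun_integral1 (distribution P X) (mK_aux mB)).
Qed.

Let K_ge0 B v : 0 <= K B v.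
Proof. exact: integral_ge0. Qed.

Let KT v : K [set: _] v = 1.
Proof.
case: hP => _ _ h1 _; rewrite -[RHS](h1 v); apply: eq_integral => x _.
by rewrite indicT mul1r.
Qed.

Let K_le1 B v : measurable B -> K B v <= 1.
Proof.
move=> mB; rewrite -(KT v); apply: ge0_le_integral => //.
- exact: (measurableT_comp (mK_aux mB) (measurable_fun_pair _ _)).
- exact: (measurableT_comp (mK_aux measurableT) (measurable_fun_pair _ _)).
- move=> x _; rewrite lee_fin ler_wpM2r// !indicE ler_nat in_setT.
  by case: (_ \in _).
Qed.

Section coupling_law.
Variable n0 : probability (TX * TV')%type R.
Hypothesis n0E : forall A, n0 A = \int[lam]_(z in A) (q z)%:E.

(* n0 is the law of (X', V') when X' is an independent copy of X reweighted so
   that X' given V' follows the conditional law of X given V = pi V'. *)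
Let n0_box (A : set TV') (B : set (TX * TV)) : measurable A -> measurable B ->
  n0 [set z | A z.2 /\ B (z.1, pi z.2)] =
  \int[P]_(w in V' @^-1` A) K B (V w).
Proof.
move=> mA mB.
have mBpi : measurable_fun [set: TX * TV']
    (fun z => (\1_B (z.1, pi z.2) * h (z.1, pi z.2))%:E).
  exact: (measurableT_comp (mK_aux mB) mxpi).
transitivity (\int[lam]_(z in [set: TX] `*` A)
    (\1_B (z.1, pi z.2) * h (z.1, pi z.2))%:E).
  rewrite n0E (_ : [set z | _] =
    ([set: TX] `*` A) `&` [set z | B (z.1, pi z.2)]); last first.
    by apply/seteqP; split => z /=; [case|case=> -[]].
  rewrite integral_mkcondr; apply: eq_integral => z _.
  rewrite patchE indicE /q (_ : (z \in _) = ((z.1, pi z.2) \in B)).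
    by case: ifPn => _; rewrite ?mul1r ?mul0r.
  by apply/idP/idP => /set_mem/mem_set.
rewrite integral_product_probability_setTX//.
have mKpi : measurable_fun A (K B \o pi).
  by apply: measurable_funTS; exact: measurableT_comp (mK mB) mpi.
apply: eq_trans (ge0_integral_pushforward (measurable_funPT V') P mA mKpi
  (fun _ _ => K_ge0 _ _)) _.
by apply: eq_integral => w _; rewrite VE.
Qed.

Variable Q : probability (TW * TY * TV)%type R.
Hypothesis QE : forall A, measurable A -> Q A = n0 (psi @^-1` A).

(** The kernel has total mass 1, so [V'] keeps its law under [n0], and [(U, V)] is a function of
    [V']. *)
Let Q_UV A : measurable A ->
  Q ((fun t => (t.1.1, t.2)) @^-1` A) = P (rv_pair U V @^-1` A).
Proof.
move=> mA.
have mtp : measurable_fun [set: TV'] (fun v => (tau v, pi v)).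
  exact: measurable_fun_pair.
have mA' : measurable ((fun v => (tau v, pi v)) @^-1` A).
  by rewrite -[X in measurable X]setTI; exact: mtp.
have mA2 : measurable ((fun t : TW * TY * TV => (t.1.1, t.2)) @^-1` A).
  rewrite -[X in measurable X]setTI.
  have : measurable_fun [set: TW * TY * TV] (fun t => (t.1.1, t.2)).
    apply: measurable_fun_pair => //; exact: measurableT_comp.
  exact.
rewrite QE// (_ : psi @^-1` _ = [set z | ((fun v => (tau v, pi v)) @^-1` A) z.2 /\
    [set: TX * TV] (z.1, pi z.2)]); last by apply/seteqP; split => z // [].
rewrite n0_box//; under eq_integral do rewrite KT.
rewrite integral_cst ?mul1e; last exact: measurable_funPTI.
by congr (P _); apply/seteqP; split => w /=; rewrite /pair_fun VE UE.
Qed.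

(** Averaging the kernel over [V] restores the joint law of [(X, V)], of which [(Y, V)] is a
    function. *)
Let Q_YV A : measurable A ->
  Q ((fun t => (t.1.2, t.2)) @^-1` A) = P (rv_pair Y V @^-1` A).
Proof.
move=> mA.
have mpv : measurable_fun [set: TX * TV] (fun t => (phi t, t.2)).
  exact: measurable_fun_pair.
have mB : measurable ((fun t => (phi t, t.2)) @^-1` A).
  by rewrite -[X in measurable X]setTI; exact: mpv.
have mA2 : measurable ((fun t : TW * TY * TV => (t.1.2, t.2)) @^-1` A).
  rewrite -[X in measurable X]setTI.
  have : measurable_fun [set: TW * TY * TV] (fun t => (t.1.2, t.2)).
    apply: measurable_fun_pair => //; exact: measurableT_comp.
  exact.
rewrite QE// (_ : psi @^-1` _ = [set z | [set: TV'] z.2 /\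
    ((fun t => (phi t, t.2)) @^-1` A) (z.1, pi z.2)]); last first.
  by apply/seteqP; split => z // [].
rewrite n0_box// preimage_setT.
rewrite -(ge0_integral_distribution V (mK mB) (K_ge0 _)).
rewrite -(integral_product_probability _ _ (mK_aux mB) (K_ge0_aux _)).
transitivity (distribution P (rv_pair X V) ((fun t => (phi t, t.2)) @^-1` A)).
  case: hP => _ _ _ ->//; rewrite [RHS]integral_mkcond.
  apply: eq_integral => t _; rewrite patchE indicE.
  by case: ifPn => _; rewrite ?mul1r ?mul0r.
by congr (P _); apply/seteqP; split => w /=; rewrite /pair_fun/= YE.
Qed.

(** Under [n0] the conditional probability of the event on [Y] given [V'] is [K B'] at [pi V'],
    hence depends on [V] alone. Integrating it over an event on [(U, V)] brings in [gA] as a version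
    of the probability of the event on [U], and [K B'] is a version of [gB]. *)
Lemma markov_coupling_density : is_markov_coupling U Y V Q.
Proof.
split => // A B gA gB mA mB [mgA gA0 gAE] [mgB gB0 gBE].
have int_snd (g : TV -> R) C : measurable C -> measurable_fun [set: TV] g ->
    (forall v, (0 <= g v)%R) ->
    \int[Q]_(t in snd @^-1` C) (g t.2)%:E =
    \int[distribution P V]_(v in C) (g v)%:E.
  move=> mC mg g0.
  have mEg : measurable_fun C (EFin \o g).
    by apply: measurable_funTS; exact/measurable_EFinP.
  have Eg0 : {in C, forall v, 0 <= (EFin \o g) v} by move=> v _; rewrite lee_fin.
  apply/esym; apply: eq_trans
    (ge0_integral_pushforward measurable_snd Q mC mEg Eg0).
  apply: eq_measure_integral => D mD _.
  transitivity (Q ((fun t : TW * TY * TV => (t.1.1, t.2))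
    @^-1` ([set: TW] `*` D))).
    rewrite Q_UV; last exact: measurableX.
    by congr (P _); apply/seteqP; split => w // [].
  by congr (Q _); apply/seteqP; split => t // [].
have mU : measurable (U @^-1` A) by exact: measurable_funPTI.
have gA_P C : measurable C ->
    P (U @^-1` A `&` V @^-1` C) = \int[distribution P V]_(v in C) (gA v)%:E.
  move=> mC; rewrite -int_snd// -gAE//.
  transitivity (P (rv_pair U V @^-1` (A `*` C))); first by [].
  by rewrite -Q_UV//; exact: measurableX.
pose B' := phi @^-1` B.
have mB' : measurable B'.
  by rewrite -[X in measurable X]setTI; exact: mphi.
have K_fin v : K B' v \is a fin_num.
  by rewrite ge0_fin_numE ?K_ge0// (le_lt_trans (K_le1 _ mB'))// ltry.
have mfK : measurable_fun [set: TV] (fun v => fine (K B' v)).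
  by apply: measurableT_comp => //; exact: mK.
have fK0 v : (0 <= fine (K B' v))%R by exact/fine_ge0.
(* Both K B' and gB are versions of P(Y in B | V). *)
have KgB : ae_eq (distribution P V) setT (EFin \o gB) (K B').
  have gB_K C : measurable C ->
      \int[distribution P V]_(v in C) (gB v)%:E =
      \int[distribution P V]_(v in C) K B' v.
    move=> mC; rewrite -int_snd// -gBE//.
    have mCpi : measurable (pi @^-1` C).
      by rewrite -[X in measurable X]setTI; exact: mpi.
    have mS : measurable
        ((fun t : TW * TY * TV => t.1.2) @^-1` B `&` snd @^-1` C).
      apply: measurableI.
        rewrite -[X in measurable X]setTI.
        have : measurable_fun [set: TW * TY * TV] (fun t => t.1.2).
          exact: measurableT_comp.
        exact.
      by rewrite -[X in measurable X]setTI; exact: measurable_snd.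
    rewrite QE// (_ : psi @^-1` _ = [set z | (pi @^-1` C) z.2 /\
      B' (z.1, pi z.2)]); last by apply/seteqP; split => z [].
    rewrite n0_box// (ge0_integral_pushforward (measurable_funPT V) P mC)//.
    - by congr (integral P _ _); apply/seteqP; split => w /=; rewrite VE.
    - by apply: measurable_funTS; exact: mK.
  apply: integral_ae_eq => //.
  - apply/integrableP; split; first exact/measurable_EFinP.
    under eq_integral do rewrite /= ger0_norm//.
    rewrite gB_K//.
    apply: (@le_lt_trans _ _ (\int[distribution P V]_v cst 1 v)).
      by apply: ge0_le_integral => //; [exact: mK|move=> v _; exact: K_le1].
    rewrite integral_cst// mul1e; apply: le_lt_trans (probability_le1 _ _) _ => //.
    exact: ltry.
  - exact: mK.
  - by move=> C _ mC; exact: gB_K.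
split.
- exact: measurable_funM.
- by move=> v; rewrite mulr_ge0.
move=> C mC; rewrite (int_snd (fun v => gA v * gB v)%R)//; last 2 first.
- exact: measurable_funM.
- by move=> v; rewrite mulr_ge0.
have mtpC : measurable (tau @^-1` A `&` pi @^-1` C).
  by apply: measurableI; rewrite -[X in measurable X]setTI;
    [exact: mtau|exact: mpi].
have mS : measurable ((fun t : TW * TY * TV => t.1.1) @^-1` A `&`
    (fun t => t.1.2) @^-1` B `&` snd @^-1` C).
  apply: measurableI; last first.
    by rewrite -[X in measurable X]setTI; exact: measurable_snd.
  apply: measurableI; rewrite -[X in measurable X]setTI.
    have : measurable_fun [set: TW * TY * TV] (fun t => t.1.1).
      exact: measurableT_comp.
    exact.
  have : measurable_fun [set: TW * TY * TV] (fun t => t.1.2).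
    exact: measurableT_comp.
  exact.
rewrite QE// (_ : psi @^-1` _ = [set z | (tau @^-1` A `&` pi @^-1` C) z.2 /\
    B' (z.1, pi z.2)]); last first.
  by apply/seteqP; split => z /= [] [].
rewrite n0_box// (_ : V' @^-1` _ = U @^-1` A `&` V @^-1` C); last first.
  by apply/seteqP; split => w /=; rewrite VE UE.
rewrite (eq_integral (fun w => (fine (K B' (V w)))%:E)); last first.
  by move=> w _; rewrite fineK.
rewrite (integral_conditional_weight mU mC mgA gA0 gA_P mfK fK0).
apply: ge0_ae_eq_integral => //.
- by apply: measurable_funTS; apply/measurable_EFinP; exact: measurable_funM.
- by apply: measurable_funTS; apply/measurable_EFinP; exact: measurable_funM.
- by move=> v _; rewrite lee_fin mulr_ge0.
- by move=> v _; rewrite lee_fin mulr_ge0.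
- apply: filterS KgB => v /(_ I) /= gBv _.
  by rewrite -gBv/= mulrC.
Qed.

End coupling_law.

(** One term of the telescoping sum, meant for [V' = u^i], [V = u^{i-1}], [U = u(i)] and [Y = y^i].
    The law of [(U, Y, V)] and its Markov coupling are images under the same [psi] of laws with
    densities [h'] and [q], so data processing applies. *)
Lemma cond_mutual_info_le (h' : TX * TV' -> R) :
    is_cond_density X V' h' ->
    P.-integrable [set: Omega] (EFin \o (fun w => ln (h (X w, V w)))%R) ->
    P.-integrable [set: Omega] (EFin \o (fun w => ln (h' (X w, V' w)))%R) ->
  cond_mutual_info U Y V <=
  (\int[P]_w (ln (h' (X w, V' w)))%:E - \int[P]_w (ln (h (X w, V w)))%:E)
    * ((ln 2)^-1)%:E.
Proof.
move=> [mh' h'0 _ h'E] ih ih'.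
have q1 : \int[lam]_z (q z)%:E = 1.
  have mqE : measurable_fun [set: TX * TV'] (EFin \o q) by exact/measurable_EFinP.
  have q0 z : 0 <= (EFin \o q) z by rewrite lee_fin; exact: h0.
  rewrite (integral_product_probability _ _ mqE q0).
  rewrite (eq_integral (cst 1)); last first.
    by case: hP => _ _ h1 _ v _; exact: (h1 (pi v)).
  by rewrite integral_cst// mul1e; exact: probability_setT.
have [n0 n0E] := density_probability mq (fun z => h0 _) q1.
pose psiM := isMeasurableFun.Build _ _ _ _ psi mpsi.
pose psim : {mfun (TX * TV')%type >-> (TW * TY * TV)%type} := HB.pack psi psiM.
pose Q : probability (TW * TY * TV)%type R := distribution n0 psim.
have QE A : measurable A -> Q A = n0 (psi @^-1` A) by [].
apply: (@le_trans _ _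
    (relative_entropy (distribution P (rv_pair (rv_pair U Y) V)) Q)).
  apply: ereal_inf_lbound; exists Q => //.
  exact: (markov_coupling_density n0E QE).
have mlnh' : measurable_fun [set: TX * TV'] (fun z => ln (h' z)).
  exact: measurableT_comp.
have mlnq : measurable_fun [set: TX * TV'] (fun z => ln (q z)).
  exact: measurableT_comp.
have mlog : measurable_fun [set: TX * TV'] (fun z => (ln (h' z) - ln (q z))%:E).
  by apply/measurable_EFinP; exact: measurable_funB.
have iP : P.-integrable [set: Omega] (fun w => (ln (h' (X w, V' w)))%:E -
    (ln (h (X w, V w)))%:E) by exact: integrableB.
have intE : \int[distribution P (rv_pair X V')]_z (ln (h' z) - ln (q z))%:E =
    \int[P]_w (ln (h' (X w, V' w)))%:E - \int[P]_w (ln (h (X w, V w)))%:E.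
  rewrite -integralB//.
  rewrite (integral_pushforward_measurable P
    (measurable_funPT (rv_pair X V')) mlog).
  by apply: eq_integral => w _; rewrite EFinB /q/= VE.
rewrite -intE.
apply: (@relative_entropy_pushforward_le _ _ _ _ _ lam
  (distribution P (rv_pair X V')) n0 _ _ h' q psi) => //.
- by move=> z; exact: h0.
- move=> A mA; rewrite /distribution /pushforward; congr (P _).
  apply/funext => w; congr (A _).
  rewrite -[LHS]/(U w, Y w, V w) UE YE.
  by rewrite -[RHS]/(tau (V' w), phi (X w, pi (V' w)), pi (V' w)) -VE.
(* At [(X, V')] the function [q] equals [h] at [(X, V)], which is almost surely positive since [h]
   is a density of that law. *)
- apply: (ae_preimage (phi := fun z => (z.1, pi z.2)) mxpi _
    (ae_density_gt0 mh h0 (mu := product_probability (distribution P X)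
      (distribution P V)) (nu := distribution P (rv_pair X V)) _)).
    move=> A mA; rewrite /distribution /pushforward; congr (P _).
    by apply/seteqP; split => w /=; rewrite /pair_fun/= VE.
  by case: hP.
- apply: (integrable_pushforward (measurable_funPT (rv_pair X V')) mlog) => //.
  by apply: eq_integrable iP => // w _; rewrite /= EFinB /q VE.
Qed.

End markov_coupling.

(** * The feedback loop *)

Section factorization.
Context d (Omega : measurableType d) (R : realType) (P : probability Omega R).
Context d0 (TS : measurableType d0).

(** The event [E] allows for the inputs, which are functions of the decoder side information only
    once the codewords are fixed. *)
Definition factors_on d1 (T : measurableType d1) (E : set Omega)
    (Z : Omega -> T) (S : Omega -> TS) : Prop :=
  exists2 f : TS -> T, measurable_fun [set: TS] f &
    forall w, E w -> Z w = f (S w).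

Variables (E : set Omega) (S : Omega -> TS).

Lemma factors_on_cst d1 (T : measurableType d1) (Z : Omega -> T) t :
  (forall w, E w -> Z w = t) -> factors_on E Z S.
Proof. by move=> Zt; exists (cst t). Qed.

Lemma factors_on_comp d1 d2 (T1 : measurableType d1) (T2 : measurableType d2)
    (Z : Omega -> T1) (g : T1 -> T2) :
    measurable_fun [set: T1] g -> factors_on E Z S ->
  factors_on E (fun w => g (Z w)) S.
Proof.
move=> mg [f mf Zf]; exists (g \o f); first exact: measurableT_comp.
by move=> w Ew; rewrite Zf.
Qed.

Lemma factors_on_pair d1 d2 (T1 : measurableType d1) (T2 : measurableType d2)
    (Z1 : Omega -> T1) (Z2 : Omega -> T2) :
    factors_on E Z1 S -> factors_on E Z2 S ->
  factors_on E (fun w => (Z1 w, Z2 w)) S.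
Proof.
move=> [f1 mf1 Z1f] [f2 mf2 Z2f]; exists (fun s => (f1 s, f2 s)).
  exact: measurable_fun_pair.
by move=> w Ew; rewrite Z1f// Z2f.
Qed.

Lemma factors_on_hist d1 (T : measurableType d1) (z : nat -> {RV P >-> T}) n :
    (forall i, (i < n)%N -> factors_on E (z i) S) ->
  factors_on E (hist z n) S.
Proof.
move=> zS.
have /choice[f fP] (i : 'I_n) : exists f : TS -> T,
    measurable_fun [set: TS] f /\ forall w, E w -> z i w = f (S w).
  by have [f mf zf] := zS i (ltn_ord i); exists f.
exists (fun s => [tuple f i s | i < n]).
  apply/measurable_fun_tnthP => i.
  rewrite (_ : _ \o _ = f i); first by case: (fP i).
  by apply/funext => s /=; rewrite tnth_mktuple.
move=> w Ew; apply: eq_from_tnth => i.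
by rewrite !tnth_mktuple add0n; case: (fP i) => _; exact.
Qed.

End factorization.

Lemma factors_on_tnth_hist d (Omega : measurableType d) (R : realType)
    (P : probability Omega R) d1 (T : measurableType d1) (E : set Omega)
    (z : nat -> {RV P >-> T}) n i :
  (i < n)%N -> factors_on E (z i) (hist z n).
Proof.
move=> ilt; exists (fun t : n.-tuple T => tnth t (Ordinal ilt)).
  exact: measurable_tnth.
by move=> w _; rewrite tnth_mktuple.
Qed.

Lemma factors_on_trans d (Omega : measurableType d) d1 d2 d3
    (T1 : measurableType d1) (T2 : measurableType d2) (T3 : measurableType d3)
    (E : set Omega) (Z1 : Omega -> T1) (Z2 : Omega -> T2) (Z3 : Omega -> T3) :
  factors_on E Z1 Z2 -> factors_on E Z2 Z3 -> factors_on E Z1 Z3.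
Proof.
move=> [f mf Zf] [g mg Zg]; exists (f \o g); first exact: measurableT_comp.
by move=> w Ew; rewrite Zf// Zg.
Qed.

Lemma independent_rv_factors d (Omega : measurableType d) (R : realType)
    (P : probability Omega R) d1 d2 d3 (T1 : measurableType d1)
    (T2 : measurableType d2) (T3 : measurableType d3)
    (Z1 : Omega -> T1) (Z2 : Omega -> T2) (X : Omega -> T3) :
    factors_on [set: Omega] Z1 Z2 -> independent_rv P Z2 X ->
  independent_rv P Z1 X.
Proof.
move=> [f mf Zf] ind A B mA mB.
have -> : Z1 @^-1` A = Z2 @^-1` (f @^-1` A).
  by apply/seteqP; split => w /=; rewrite Zf.
by apply: ind => //; rewrite -[X in measurable X]setTI; exact: mf.
Qed.

Lemma measurable_tuple_set1 d (T : measurableType d) n (a : n.-tuple T) :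
  (forall t : T, measurable [set t]) -> measurable [set a].
Proof.
move=> mT.
rewrite (_ : [set a] = \bigcap_(i in [set: 'I_n])
    ((fun t : n.-tuple T => tnth t i) @^-1` [set tnth a i])); last first.
  apply/seteqP; split => [_ -> //|t tP].
  by apply: eq_from_tnth => i; exact: tP.
apply: fin_bigcap_measurable => // i _.
rewrite -[X in measurable X]setTI; exact: measurable_tnth.
Qed.

Lemma le_limn_esup (R : realType) (u v : nat -> \bar R) :
  (forall n, u n <= v n) -> limn_esup u <= limn_esup v.
Proof.
move=> uv; rewrite !limn_esup_lim; apply: lee_lim.
- exact: is_cvg_esups.
- exact: is_cvg_esups.
apply: nearW => n; apply: ge_ereal_sup => _ [m /= nm <-].
by apply: le_trans (uv m) _; apply: ereal_sup_ubound; exists m.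
Qed.

Lemma le_limn_einf (R : realType) (u v : nat -> \bar R) :
  (forall n, u n <= v n) -> limn_einf u <= limn_einf v.
Proof.
by move=> uv; rewrite /limn_einf leeN2; apply: le_limn_esup => n; rewrite leeN2.
Qed.

(** * The rate bound and the telescoping sum for the loop up to a finite horizon [N] *)

Section feedback_coding.
Context (R : realType)
  (dOmega dU dY dD dC dS dX : measure_display)
  (Omega : measurableType dOmega) (P : probability Omega R)
  (TU : measurableType dU) (TY : measurableType dY)
  (TD : measurableType dD) (TC : measurableType dC) (AS : measurableType dS)
  (TX : measurableType dX).
Variables (X : {RV P >-> TX}) (SD : nat -> {RV P >-> TD})
  (SEC : nat -> {RV P >-> TC})
  (y : nat -> {RV P >-> TY}) (s : nat -> {RV P >-> AS})
  (sc : nat -> {RV P >-> word}) (u : nat -> {RV P >-> TU})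
  (Hinv : forall k, {mfun (k.+1.-tuple word * k.+1.-tuple TC)%type >-> AS})
  (D : forall k, {mfun (k.+1.-tuple AS * k.+1.-tuple TD)%type >-> TU})
  (A : nat -> set word) (N : nat).
Hypothesis codewords : forall k w, A k (sc k w).
Hypothesis codewords_prefix_free : forall k, prefix_free (A k).
Hypothesis entropy_decoder :
  forall k w, s k w = Hinv k (hist sc k.+1 w, hist SEC k.+1 w).
Hypothesis decoder : forall k w, u k w = D k (hist s k.+1 w, hist SD k.+1 w).

Let SDtot k := rv_pair (SD k) (SEC k).

Hypothesis indep : independent_rv P (hist SDtot N) X.
Hypothesis y_factors : forall i, (i < N)%N ->
  factors_on [set: Omega] (y i) (rv_pair X (hist u i)).
Hypothesis rate_fin : \sum_(0 <= i < N) expected_length (sc i) < +oo.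

Let code n w : n.-tuple (seq bool) := hist sc n w.

Let weight n (a : n.-tuple (seq bool)) : R := (2^-1 ^+ size (flatten a))%R.

Let weight_gt0 n (a : n.-tuple (seq bool)) : (0 < weight a)%R.
Proof. by rewrite exprn_gt0// invr_gt0. Qed.

Let measurable_code n (a : n.-tuple (seq bool)) :
  measurable (@code n @^-1` [set a]).
Proof.
exact: (measurable_funPTI (hist sc n) (measurable_tuple_set1 (T := word) a _)).
Qed.

Let hist_factors (d1 : measure_display) (T : measurableType d1)
    (z : nat -> {RV P >-> T}) m n : (m <= n)%N ->
  factors_on [set: Omega] (hist z m) (hist z n).
Proof.
move=> mn; apply: factors_on_hist => i im.
exact: factors_on_tnth_hist (leq_trans im mn).
Qed.

(** Fixing the codewords opens the loop: each [s i] then depends only on [SEC], by lossless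
    decoding, and each [u i] on these symbols and [SD]. *)
Let u_factors_code n (a : n.-tuple (seq bool)) :
  factors_on (@code n @^-1` [set a]) (hist u n) (hist SDtot n).
Proof.
set E := _ @^-1` _.
have sc_f i : (i < n)%N -> factors_on E (sc i) (hist SDtot n).
  move=> ilt; apply: (factors_on_cst (T := word) _ (t := tnth a (Ordinal ilt))).
  by move=> w <-; rewrite tnth_mktuple.
have SDtot_f i : (i < n)%N -> factors_on E (SDtot i) (hist SDtot n).
  by move=> ilt; exact: factors_on_tnth_hist.
have SD_f i : (i < n)%N -> factors_on E (SD i) (hist SDtot n).
  by move=> ilt; exact: (factors_on_comp measurable_fst (SDtot_f i ilt)).
have SEC_f i : (i < n)%N -> factors_on E (SEC i) (hist SDtot n).
  by move=> ilt; exact: (factors_on_comp measurable_snd (SDtot_f i ilt)).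
have s_f i : (i < n)%N -> factors_on E (s i) (hist SDtot n).
  move=> ilt; rewrite (_ : (s i : Omega -> AS) =
      fun w => Hinv i (hist sc i.+1 w, hist SEC i.+1 w)); last first.
    by apply/funext => w; rewrite entropy_decoder.
  apply: factors_on_comp => //; apply: factors_on_pair;
    apply: factors_on_hist => j ji.
  - exact: sc_f (leq_trans ji ilt).
  - exact: SEC_f (leq_trans ji ilt).
apply: factors_on_hist => i ilt.
rewrite (_ : (u i : Omega -> TU) =
    fun w => D i (hist s i.+1 w, hist SD i.+1 w)); last first.
  by apply/funext => w; rewrite decoder.
apply: factors_on_comp => //; apply: factors_on_pair;
  apply: factors_on_hist => j ji.
- exact: s_f (leq_trans ji ilt).
- exact: SD_f (leq_trans ji ilt).
Qed.

Let integral_weight n : (n <= N)%N ->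
  P.-integrable [set: Omega] (EFin \o (fun w => - ln (weight (code n w)))%R) /\
  \int[P]_w (- ln (weight (code n w)))%:E =
    (ln 2)%:E * \sum_(0 <= i < n) expected_length (sc i).
Proof.
move=> nN.
have mlen i : measurable_fun [set: Omega]
    (fun w => (size (sc i w))%:R%:E : \bar R).
  apply/measurable_EFinP.
  apply: (measurableT_comp (f := fun a : word => (size a)%:R : R)) => //.
have len0 i w : 0 <= (size (sc i w))%:R%:E :> \bar R by rewrite lee_fin.
have wE w : (- ln (weight (code n w)))%:E =
    (ln 2)%:E * \sum_(0 <= i < n) (size (sc i w))%:R%:E :> \bar R.
  rewrite /weight lnXn ?invr_gt0// lnV ?posrE// mulNrn opprK.
  rewrite -(mulr_natr (ln 2)) EFinM.
  congr (_ * _); rewrite sumEFin size_flatten sumnE big_map; congr EFin.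
  rewrite big_tuple natr_sum big_mkord; apply: eq_bigr => i _.
  by rewrite tnth_mktuple add0n.
have ln2 : (0 <= ln 2 :> R)%R by rewrite ltW// ln_gt0// ltr1n.
have intE : \int[P]_w (- ln (weight (code n w)))%:E =
    (ln 2)%:E * \sum_(0 <= i < n) expected_length (sc i).
  under eq_integral do rewrite wE.
  rewrite ge0_integralZl//; last 2 first.
  - exact: emeasurable_sum.
  - by move=> w _; exact: sume_ge0.
  by rewrite ge0_integral_sum.
split => //; apply/integrableP; split.
  rewrite (_ : EFin \o _ = fun w =>
    (ln 2)%:E * \sum_(0 <= i < n) (size (sc i w))%:R%:E); last exact/funext.
  by apply: measurable_funeM; exact: emeasurable_sum.
rewrite (eq_integral (fun w => (- ln (weight (code n w)))%:E)); last first.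
  by move=> w _; rewrite gee0_abs//= wE; apply: mule_ge0; [|exact: sume_ge0].
rewrite intE lte_mul_pinfty//.
apply: le_lt_trans rate_fin.
apply: lee_sum_nneg_natr => // i _ _; exact: integral_ge0.
Qed.

(** The coded observation is [u^{n-1}], with the codeword block as [W], the decoder side information
    as [S] and the weight [2^{-|w|}], whose negative logarithm is the total length times [ln 2]. *)
Lemma log_density_rate n : (n <= N)%N -> exists2 h : TX * n.-tuple TU -> R,
  is_cond_density X (hist u n) h &
  [/\ P.-integrable [set: Omega] (EFin \o (fun w => ln (h (X w, hist u n w)))%R),
      0 <= \int[P]_w (ln (h (X w, hist u n w)))%:E &
      \int[P]_w (ln (h (X w, hist u n w)))%:E <=
        (ln 2)%:E * \sum_(0 <= i < n) expected_length (sc i)].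
Proof.
move=> nN.
have ind : independent_rv P (hist SDtot n) X.
  exact: independent_rv_factors (hist_factors _ nN) indep.
have /choice[delta deltaP] (a : n.-tuple (seq bool)) :
    exists f : n.-tuple (TD * TC)%type -> n.-tuple TU,
      measurable_fun [set: n.-tuple (TD * TC)%type] f /\
      forall w, code n w = a -> hist u n w = f (hist SDtot n w).
  by have [f mf uf] := u_factors_code a; exists f.
have mdelta a := (deltaP a).1.
have uE w : hist u n w = delta (code n w) (hist SDtot n w).
  exact: (deltaP (code n w)).2.
have [h hP] := cond_density_exists (coded_observation_dominates ind
  mdelta uE).
exists h => //.
have kraft : forall r : seq (n.-tuple (seq bool)), uniq r ->
    (forall a, a \in r -> exists w, code n w = a) ->
    (\sum_(a <- r) weight a <= 1)%R.
  move=> r ur rW; apply: (kraft_inequality_tuple R codewords_prefix_free ur).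
  move=> a /rW[w <-] i; rewrite tnth_mktuple; exact: codewords.
have [ic <-] := integral_weight nN.
exact: (log_density_bound ind (@measurable_code n) mdelta uE (@weight_gt0 n)
  kraft hP ic).
Qed.

(** Induction on [n]: each new term is at most a difference of consecutive log-density integrals. At
    [n = 0] the sum is empty and nonnegativity of the integral suffices. *)
Lemma sum_cond_mutual_info_le n h : (n <= N)%N ->
    is_cond_density X (hist u n) h ->
    P.-integrable [set: Omega] (EFin \o (fun w => ln (h (X w, hist u n w)))%R) ->
    0 <= \int[P]_w (ln (h (X w, hist u n w)))%:E ->
  \sum_(0 <= i < n) cond_mutual_info (u i) (hist y i.+1) (hist u i) <=
    \int[P]_w (ln (h (X w, hist u n w)))%:E * ((ln 2)^-1)%:E.
Proof.
have ln2 : (0 <= (ln 2)^-1 :> R)%R by rewrite invr_ge0 ltW// ln_gt0// ltr1n.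
elim: n h => [|n IH] h nN hP ih J0.
  by rewrite big_geq// mule_ge0// lee_fin.
have [h' hP' [ih' J0' _]] := log_density_rate (ltnW nN).
rewrite big_nat_recr//=.
(* [proj] drops the last input, [tau] reads it, and [phi] replays the plant: [y^n] depends on [X]
   and [u^{n-1}]. *)
have [proj mproj VE] := hist_factors u (leqnSn n).
have [tau mtau UE] : factors_on [set: Omega] (u n) (hist u n.+1).
  exact: factors_on_tnth_hist.
have [phi mphi YE] : factors_on [set: Omega] (hist y n.+1)
    (rv_pair X (hist u n)).
  apply: factors_on_hist => i ilt.
  apply: factors_on_trans (y_factors (leq_trans ilt nN)) _.
  apply: factors_on_pair.
    by exists fst.
  apply: factors_on_trans (hist_factors u (_ : (i <= n)%N)) _ => //.
  by exists snd.
have le1 := cond_mutual_info_le mproj mtau mphi (fun w => VE w I)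
  (fun w => UE w I) (fun w => YE w I) hP' hP ih' ih.
apply: le_trans (leeD (IH _ (ltnW nN) hP' ih' J0') le1) _.
(* Finiteness of both integrals permits the cancellation in the extended reals. *)
have fJ := integrable_fin_num measurableT ih.
have fJ' := integrable_fin_num measurableT ih'.
rewrite /= in fJ fJ'; rewrite -(fineK fJ) -(fineK fJ') -EFinB -!EFinM -EFinD.
by rewrite lee_fin -mulrDl subrKC.
Qed.

End feedback_coding.

Theorem theorem3 (R : realType)
  (dOmega dU dY dE dD dC dS : measure_display)
  (Omega : measurableType dOmega) (P : probability Omega R)
  (TU : measurableType dU) (TY : measurableType dY)
  (TE : measurableType dE) (TD : measurableType dD) (TC : measurableType dC)
  (* the fixed countable alphabet of s, with its discrete sigma-algebra *)
  (AS : measurableType dS)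
  (AS_countable : countable [set: AS])
  (AS_discrete : forall a : AS, measurable [set a])
  (no nd : nat)
  (xo : {RV P >-> no.-tuple R}) (d : nat -> {RV P >-> nd.-tuple R})
  (SE : nat -> {RV P >-> TE}) (SD : nat -> {RV P >-> TD})
  (SEC : nat -> {RV P >-> TC})
  (y : nat -> {RV P >-> TY}) (s : nat -> {RV P >-> AS})
  (sc : nat -> {RV P >-> word}) (u : nat -> {RV P >-> TU})
  (F : forall k, {mfun (k.-tuple TU * k.+1.-tuple (nd.-tuple R)
                        * no.-tuple R)%type >-> TY})
  (E : forall k, {mfun (k.+1.-tuple TY * k.+1.-tuple TE)%type >-> AS})
  (H : forall k, {mfun (k.+1.-tuple AS * k.+1.-tuple TC)%type >-> word})
  (Hinv : forall k, {mfun (k.+1.-tuple word * k.+1.-tuple TC)%type >-> AS})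
  (D : forall k, {mfun (k.+1.-tuple AS * k.+1.-tuple TD)%type >-> TU})
  (A : nat -> set word)
  (plant : forall k w, y k w = F k (hist u k w, hist d k.+1 w, xo w))
  (encoder : forall k w, s k w = E k (hist y k.+1 w, hist SE k.+1 w))
  (entropy_encoder : forall k w, sc k w = H k (hist s k.+1 w, hist SEC k.+1 w))
  (codewords : forall k w, A k (sc k w))
  (codewords_prefix_free : forall k, prefix_free (A k))
  (entropy_decoder :
    forall k w, s k w = Hinv k (hist sc k.+1 w, hist SEC k.+1 w))
  (decoder : forall k w, u k w = D k (hist s k.+1 w, hist SD k.+1 w)) :
  let SEtot k := rv_pair (SE k) (SEC k) in
  let SDtot k := rv_pair (SD k) (SEC k) in
  (forall k, independent_rv P
     (rv_pair (hist SEtot k.+1) (hist SDtot k.+1)) (rv_pair xo (hist d k.+1))) ->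
  (forall k i, (i < k)%N ->
     markov_chain P (segment SDtot i.+1 (k - i)) (hist SDtot i.+1)
       (hist SEtot i.+1)) ->
  [/\ forall k, directed_info y u k <=
        \sum_(0 <= i < k.+1) expected_length (sc i),
      limn_esup (fun k => (k.+1%:R^-1)%:E * directed_info y u k) <=
        limn_esup (fun k => (k.+1%:R^-1)%:E *
          \sum_(0 <= i < k.+1) expected_length (sc i)) &
      limn_einf (fun k => (k.+1%:R^-1)%:E * directed_info y u k) <=
        limn_einf (fun k => (k.+1%:R^-1)%:E *
          \sum_(0 <= i < k.+1) expected_length (sc i))].
Proof.
move=> SEtot SDtot indep _.
have main k : directed_info y u k <=
    \sum_(0 <= i < k.+1) expected_length (sc i).
  (* An infinite total rate makes the bound trivial; a finite one makes the codeword lengths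
     integrable. *)
  have [rate_fin|] := ltP (\sum_(0 <= i < k.+1) expected_length (sc i)) +oo;
    last by apply: le_trans; exact: leey.
  (* Everything exogenous that drives the plant up to time [k]. *)
  pose X := rv_pair xo (hist d k.+1).
  have indep_SD : independent_rv P (hist SDtot k.+1) X.
    by apply: independent_rv_factors (indep k); exists snd.
  have y_factors i : (i < k.+1)%N ->
      factors_on [set: Omega] (y i) (rv_pair X (hist u i)).
    move=> ilt; rewrite (_ : (y i : Omega -> TY) =
        fun w => F i (hist u i w, hist d i.+1 w, xo w)); last first.
      by apply/funext => w; rewrite plant.
    apply: factors_on_comp => //; apply: factors_on_pair; last first.
      by exists (fst \o fst) => //; exact: measurableT_comp.
    apply: factors_on_pair; first by exists snd.
    apply: factors_on_hist => j ji.
    apply: (@factors_on_trans _ _ _ _ _ _ _ _ _ _ (hist d k.+1)).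
      exact: factors_on_tnth_hist (leq_trans ji ilt).
    by exists (snd \o fst) => //; exact: measurableT_comp.
  have [h hP [ih J0 J_le]] := log_density_rate codewords codewords_prefix_free
    entropy_decoder decoder indep_SD rate_fin (leqnn k.+1).
  apply: le_trans (sum_cond_mutual_info_le codewords codewords_prefix_free
    entropy_decoder decoder indep_SD y_factors rate_fin (leqnn k.+1) hP ih J0) _.
  have ln2 : (0 < ln 2 :> R)%R by rewrite ln_gt0// ltr1n.
  (* Back from nats to bits: the factor [ln 2] of the rate bound cancels the one dividing the
     information. *)
  apply: (@le_trans _ _ ((ln 2)%:E *
      (\sum_(0 <= i < k.+1) expected_length (sc i)) * ((ln 2)^-1)%:E)).
    by rewrite lee_wpmul2r// lee_fin invr_ge0 ltW.
  by rewrite muleAC -EFinM divff ?mul1e// gt_eqF.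
split => //.
- by apply: le_limn_esup => k; rewrite lee_wpmul2l// lee_fin invr_ge0.
- by apply: le_limn_einf => k; rewrite lee_wpmul2l// lee_fin invr_ge0.
Qed.
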